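(* Let $S^{\dagger}=S/(a^2-y)$, let $K^{\dagger}$ be its fraction field, and let $BMW_3^{\dagger}=\widetilde{BMW}_3\otimes_R S^{\dagger}$. Then $BMW_3^{\dagger}\otimes_{S^{\dagger}}K^{\dagger}$ has dimension $16$ over $K^{\dagger}$.
   Context: $R=\mathbb{Q}[a,b,c,(abc)^{-1}]$, $x=b+c$, $y=bc$, $S=R[x^{-1}]$. $\widetilde{BMW}_3$ is the quotient of the group algebra $RB_3$ of the braid group on 3 strands (Artin generators $s_1,s_2$) by the relations $(s_i-a)(s_i-b)(s_i-c)=0$ for $i=1,2$ and $$-y\,s_1s_2^{-1}s_1+y^2s_2^{-1}s_1s_2^{-1}-s_1s_2s_1-xy^2s_2^{-2}+x\,s_1^2+y^3s_2^{-1}s_1^{-1}s_2^{-1}=0.$$ *)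

(* Defs.v *)
From HB Require Import structures.
From mathcomp Require Import all_boot all_order all_algebra.
From mathcomp Require Import generic_quotient ring_quotient fraction.
From mathcomp Require Import ring boolp finmap.
From mathcomp Require Import mpoly monalg.

Set Implicit Arguments.
Unset Strict Implicit.
Unset Printing Implicit Defensive.

Import GRing.Theory.
Local Open Scope ring_scope.
Local Open Scope quotient_scope.

Notation Qabc := (mpoly 3 rat).
Notation Fabc := {fraction Qabc}.
Local Notation "x %:F" := (@FracField.tofrac _ x).

Section Generators.
Definition aP : Qabc := 'X_(inord 0).
Definition bP : Qabc := 'X_(inord 1).
Definition cP : Qabc := 'X_(inord 2).
End Generators.

(* R and S below are realized inside the field Q(a,b,c).
   For a subring [A] of a field and a nonzero [u] in [A], this is the subring [A[u^-1]]. *)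
Definition localize (F : fieldType) (A : {pred F}) (u : F) : {pred F} :=
  fun f => `[< exists n, f * u ^+ n \in A >].

Lemma localize_subring (F : fieldType) (A : subringClosed F) (u : F) :
  u \in A -> subring_closed (localize A u).
Proof.
move=> Au; split=> [|f g|f g]; first by apply/asboolP; exists 0%N; rewrite mulr1 rpred1.
all: move=> /asboolP [n fA] /asboolP [m gA]; apply/asboolP; exists (n + m)%N.
  have -> : (f - g) * u ^+ (n + m) = f * u ^+ n * u ^+ m - g * u ^+ m * u ^+ n.
    by rewrite exprD; ring.
  by rewrite rpredB // rpredM // rpredX.
by rewrite exprD mulrACA rpredM.
Qed.

Lemma localize_sub (F : fieldType) (A : {pred F}) (u f : F) :
  f \in A -> f \in localize A u.
Proof. by move=> Af; apply/asboolP; exists 0%N; rewrite mulr1. Qed.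

Definition polyb : {pred Fabc} := fun f => `[< exists p : Qabc, f = p%:F >].

Lemma polybP (p : Qabc) : p%:F \in polyb.
Proof. by apply/asboolP; exists p. Qed.

Lemma polyb_subring : subring_closed polyb.
Proof.
split=> [|_ _ /asboolP [p ->] /asboolP [q ->]|_ _ /asboolP [p ->] /asboolP [q ->]].
- by rewrite -tofrac1 polybP.
- by rewrite -tofracB polybP.
- by rewrite -tofracM polybP.
Qed.

HB.instance Definition _ := GRing.isSubringClosed.Build Fabc polyb polyb_subring.

Definition Rb : {pred Fabc} := localize polyb (aP * bP * cP)%:F.
Definition Rb_subring : subring_closed Rb := localize_subring (polybP _).
HB.instance Definition _ := GRing.isSubringClosed.Build Fabc Rb Rb_subring.

Lemma RbP (p : Qabc) : p%:F \in Rb.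
Proof. exact/localize_sub/polybP. Qed.

Definition Sb : {pred Fabc} := localize Rb (bP + cP)%:F.
Definition Sb_subring : subring_closed Sb := localize_subring (RbP _).
HB.instance Definition _ := GRing.isSubringClosed.Build Fabc Sb Sb_subring.

Record ringR := RingR { valR : Fabc; valR_subproof : valR \in Rb }.
HB.instance Definition _ := [isSub for valR].
HB.instance Definition _ := [Choice of ringR by <:].
HB.instance Definition _ := [SubChoice_isSubComNzRing of ringR by <:].

Record ringS := RingS { valS : Fabc; valS_subproof : valS \in Sb }.
HB.instance Definition _ := [isSub for valS].
HB.instance Definition _ := [Choice of ringS by <:].
HB.instance Definition _ := [SubChoice_isSubComNzRing of ringS by <:].

Definition R_to_S (r : ringR) : ringS := RingS (localize_sub _ (valR_subproof r)).

Lemma R_to_S_zmod : zmod_morphism R_to_S.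
Proof. by move=> r s; apply/val_inj. Qed.

Lemma R_to_S_monoid : monoid_morphism R_to_S.
Proof. by split=> [|r s]; apply/val_inj. Qed.

HB.instance Definition _ := GRing.isZmodMorphism.Build ringR ringS R_to_S R_to_S_zmod.
HB.instance Definition _ := GRing.isMonoidMorphism.Build ringR ringS R_to_S R_to_S_monoid.

Definition aR : ringR := RingR (RbP aP).
Definition bR : ringR := RingR (RbP bP).
Definition cR : ringR := RingR (RbP cP).
Definition xR : ringR := bR + cR.
Definition yR : ringR := bR * cR.

(* The ideal (a^2 - y) of S; it is prime, so that K^dagger makes sense. *)
Definition dagger_ideal : {pred ringS} :=
  fun s => `[< exists t, s = (R_to_S aR ^+ 2 - R_to_S yR) * t >].

Section DaggerPrime.

(* The substitution c := a^2 / b, whose kernel is (a^2 - bc). *)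
Definition dagger_subst : Qabc -> Fabc :=
  mpoly.mmap (@FracField.tofrac Qabc \o @mpolyC 3 rat) (fun i => nth 0 [:: aP%:F; bP%:F; aP%:F ^+ 2 / bP%:F] i).
Local Notation psi := dagger_subst.
HB.instance Definition _ := GRing.RMorphism.on psi.
Local Notation J := (aP ^+ 2 - bP * cP).

Lemma psiM p q : psi (p * q) = psi p * psi q.
Proof. exact: rmorphM. Qed.
Lemma psi_a : psi aP = aP%:F.
Proof. by rewrite /psi mpoly.mmapX mpoly.mmap1U inordK. Qed.
Lemma psi_b : psi bP = bP%:F.
Proof. by rewrite /psi mpoly.mmapX mpoly.mmap1U inordK. Qed.
Lemma psi_c : psi cP = aP%:F ^+ 2 / bP%:F.
Proof. by rewrite /psi mpoly.mmapX mpoly.mmap1U inordK. Qed.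
Lemma psi_C k : psi (mpolyC 3 k) = (mpolyC 3 k)%:F.
Proof. by rewrite /psi mpoly.mmapC. Qed.

Lemma eval1_neq0 (p : Qabc) : p.@[fun=> 1] != 0 -> p%:F != 0.
Proof. by apply: contraNneq => /eqP; rewrite tofrac_eq0 => /eqP->; rewrite rmorph0. Qed.

Lemma aF_neq0 : aP%:F != 0.
Proof. by rewrite eval1_neq0 // mevalXU. Qed.
Lemma bF_neq0 : bP%:F != 0.
Proof. by rewrite eval1_neq0 // mevalXU. Qed.

Lemma cF_neq0 : cP%:F != 0.
Proof. by rewrite eval1_neq0 // mevalXU. Qed.

Lemma psi_J : psi J = 0.
Proof.
by rewrite rmorphB rmorphXn rmorphM /= psi_a psi_b psi_c mulrC divfK ?subrr ?bF_neq0.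
Qed.

Definition psi_reduced p := exists N g q,
  bP ^+ N * p = J * g + q /\ psi q = q%:F.

Lemma psi_reducedD p p' : psi_reduced p -> psi_reduced p' -> psi_reduced (p + p').
Proof.
move=> [N [g [q [e eq]]]] [N' [g' [q' [e' eq']]]].
exists (N + N')%N, (bP ^+ N' * g + bP ^+ N * g'), (bP ^+ N' * q + bP ^+ N * q').
split; last by rewrite !(rmorphD, rmorphM, rmorphXn) /= psi_b eq eq'.
transitivity (bP ^+ N' * (bP ^+ N * p) + bP ^+ N * (bP ^+ N' * p')).
  by rewrite exprD; ring.
by rewrite e e'; ring.
Qed.

Lemma psi_reducedM p p' : psi_reduced p -> psi_reduced p' -> psi_reduced (p * p').
Proof.
move=> [N [g [q [e eq]]]] [N' [g' [q' [e' eq']]]].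
exists (N + N')%N, (J * g * g' + g * q' + q * g'), (q * q').
split; last by rewrite !rmorphM /= eq eq'.
by rewrite exprD mulrACA e e'; ring.
Qed.

Lemma psi_reduced_fix p : psi p = p%:F -> psi_reduced p.
Proof. by move=> ep; exists 0%N, 0, p; rewrite expr0 mul1r mulr0 add0r. Qed.

Lemma psi_reducedX (i : 'I_3) : psi_reduced 'X_i.
Proof.
have := ltn_ord i; case def_i: (nat_of_ord i) => [|[|[|//]]] _.
- have -> : 'X_i = aP by congr ('X_ _); apply/val_inj; rewrite /= inordK.
  exact/psi_reduced_fix/psi_a.
- have -> : 'X_i = bP by congr ('X_ _); apply/val_inj; rewrite /= inordK.
  exact/psi_reduced_fix/psi_b.
- have -> : 'X_i = cP by congr ('X_ _); apply/val_inj; rewrite /= inordK.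
  exists 1%N, (-1), (aP ^+ 2); split; first by rewrite expr1; ring.
  by rewrite !rmorphXn /= psi_a.
Qed.

Lemma psi_reducedP p : psi_reduced p.
Proof.
elim/mpolyind: p => [|k m p _ _ IHp]; first by apply: psi_reduced_fix; rewrite !rmorph0.
apply: psi_reducedD => //; rewrite -mul_mpolyC.
apply: psi_reducedM; first exact/psi_reduced_fix/psi_C.
rewrite mpolyXE_id; apply: big_ind => [||i _].
- by apply: psi_reduced_fix; rewrite !rmorph1.
- exact: psi_reducedM.
elim: (m i) => [|n IHn]; first by apply: psi_reduced_fix; rewrite !rmorph1.
by rewrite exprS; apply: psi_reducedM => //; apply: psi_reducedX.
Qed.

Lemma psi_ker p : psi p = 0 -> exists N g, bP ^+ N * p = J * g.
Proof.
move=> p0; have [N [g [q [e eq]]]] := psi_reducedP p; exists N, g.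
have /(congr1 psi) := e; rewrite rmorphD !rmorphM /= p0 psi_J mulr0 mul0r add0r eq.
by move=> /esym/eqP; rewrite tofrac_eq0 e => /eqP ->; rewrite addr0.
Qed.

Lemma Sb_poly (p : Qabc) : p%:F \in Sb.
Proof. exact/localize_sub/RbP. Qed.

Lemma abc_neq0 : (aP * bP * cP)%:F != 0.
Proof. by rewrite eval1_neq0 // !rmorphM /= !mevalXU. Qed.

Lemma bc_neq0 : (bP + cP)%:F != 0.
Proof. by rewrite eval1_neq0 // rmorphD /= !mevalXU. Qed.

Lemma Sb_abcV : (aP * bP * cP)%:F^-1 \in Sb.
Proof.
apply: localize_sub; apply/asboolP; exists 1%N.
by rewrite mulVf ?abc_neq0 // -tofrac1 polybP.
Qed.

Lemma Sb_xV : (bP + cP)%:F^-1 \in Sb.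
Proof. by apply/asboolP; exists 1%N; rewrite mulVf ?bc_neq0 // -tofrac1 RbP. Qed.

Lemma Sb_bV : bP%:F^-1 \in Sb.
Proof.
have key (F : fieldType) (u v w : F) : u != 0 -> v != 0 -> w != 0 ->
    v^-1 = (u * v * w)^-1 * (u * w).
  by move=> u0 v0 w0; field; rewrite u0 v0 w0.
rewrite (key _ _ _ _ aF_neq0 bF_neq0 cF_neq0) -!tofracM.
by rewrite rpredM ?Sb_abcV ?Sb_poly.
Qed.

Definition dagger_den (d : Qabc) := psi d != 0 /\ d%:F^-1 \in Sb.

Lemma dagger_denM d e : dagger_den d -> dagger_den e -> dagger_den (d * e).
Proof.
move=> [d0 dS] [e0 eS].
split.
  rewrite psiM.
  exact (mulf_neq0 d0 e0).
rewrite tofracM.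
rewrite invfM.
exact (rpredM dS eS).
Qed.

Lemma dagger_den1 : dagger_den 1.
Proof.
split; first by rewrite (rmorph1 psi) oner_neq0.
by rewrite tofrac1 invr1 rpred1.
Qed.

Lemma dagger_denX d n : dagger_den d -> dagger_den (d ^+ n).
Proof.
move=> dd; elim: n => [|n IHn]; first exact: dagger_den1.
by rewrite exprS; apply: dagger_denM.
Qed.

Lemma ringS_frac (s : ringS) :
  exists d p, dagger_den d /\ val s * d%:F = p%:F.
Proof.
case: s => f /= /asboolP [n /asboolP [m /asboolP [p e]]].
exists ((bP + cP) ^+ n * (aP * bP * cP) ^+ m), p; split; last first.
  by rewrite -e tofracM !tofracXn mulrA.
apply: dagger_denM; apply: dagger_denX; split; rewrite ?Sb_xV ?Sb_abcV //.
  rewrite rmorphD /= psi_b psi_c; apply/eqP => /(congr1 ( *%R bP%:F)).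
  rewrite mulr0 mulrDr [X in _ + X]mulrC divfK ?bF_neq0 // -tofracXn -tofracM -tofracD.
  apply/eqP/eval1_neq0; rewrite rmorphD rmorphXn rmorphM /= !mevalXU.
  by rewrite mulr1 expr1n.
rewrite !rmorphM /= psi_a psi_b psi_c.
apply: (mulf_neq0 (mulf_neq0 aF_neq0 bF_neq0)).
exact: (mulf_neq0 (expf_neq0 2 aF_neq0) (invr_neq0 bF_neq0)).
Qed.

Lemma valSM (s t : ringS) : val (s * t) = val s * val t.
Proof. reflexivity. Qed.

Lemma val_J : val (R_to_S aR ^+ 2 - R_to_S yR) = J%:F.
Proof.
rewrite tofracB tofracXn tofracM.
rewrite (rmorphB (val : ringS -> Fabc)).
rewrite (rmorphXn (val : ringS -> Fabc)).
reflexivity.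
Qed.

Lemma dagger_cancel (F : fieldType) (p u g b d : F) N :
  d != 0 -> b != 0 -> b ^+ N * p = u * g ->
  p = u * (g * (b^-1 ^+ N * d^-1)) * d.
Proof.
move=> d0 b0 e; apply: (mulfI (expf_neq0 N b0)); rewrite e exprVn.
have := expf_neq0 N b0; move: (b ^+ N) => v v0; field; exact/andP.
Qed.

Lemma dagger_idealE s d p : dagger_den d -> val s * d%:F = p%:F ->
  (s \in dagger_ideal) = (psi p == 0).
Proof.
move=> [d0 dS] e; have dF0 : d%:F != 0.
  by rewrite tofrac_eq0; apply: contraNneq d0 => ->; rewrite rmorph0.
apply/asboolP/eqP => [[t def_s]|/psi_ker [N [g eg]]].
  have [d' [p' [[d'0 _] e']]] := ringS_frac t.
  have : p * d' = J * p' * d.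
    apply/eqP; rewrite -tofrac_eq; apply/eqP.
    rewrite [LHS]tofracM [RHS]tofracM [X in X * d%:F]tofracM -e -e' def_s.
    rewrite valSM val_J.
    move: (J%:F) (val t) (d%:F) (d'%:F) => u v w z; ring.
  move=> /(congr1 psi); rewrite !rmorphM /= psi_J !mul0r => /eqP.
  by rewrite mulf_eq0 (negPf d'0) orbF => /eqP.
have tS : g%:F * (bP%:F^-1 ^+ N * d%:F^-1) \in Sb.
  by rewrite !rpredM ?rpredX ?Sb_bV ?Sb_poly.
exists (RingS tS); apply/val_inj.
apply: (mulIf dF0); rewrite e valSM val_J.
apply: dagger_cancel dF0 bF_neq0 _.
by rewrite -tofracXn -!tofracM eg.
Qed.

Lemma dagger_ideal_closed : idealr_closed dagger_ideal.
Proof.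
split=> [||w u v /asboolP [s ->] /asboolP [t ->]].
- by apply/asboolP; exists 0; rewrite mulr0.
- have e : val (1 : ringS) * (1 : Qabc)%:F = (1 : Qabc)%:F.
    by rewrite (rmorph1 (val : ringS -> Fabc)) mul1r.
  by rewrite (dagger_idealE dagger_den1 e) (rmorph1 psi) oner_neq0.
by apply/asboolP; exists (w * s + t); rewrite mulrDr mulrCA.
Qed.

Lemma dagger_ideal_prime : prime_idealr_closed dagger_ideal.
Proof.
move=> s t; have [d [p [dd e]]] := ringS_frac s; have [d' [p' [dd' e']]] := ringS_frac t.
rewrite (dagger_idealE dd e) (dagger_idealE dd' e').
have est : val (s * t) * (d * d')%:F = (p * p')%:F.
  by rewrite valSM !tofracM mulrACA e e'.
by rewrite (dagger_idealE (dagger_denM dd dd') est) psiM mulf_eq0 => ->.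
Qed.

End DaggerPrime.

HB.instance Definition _ := isIdealr.Build ringS dagger_ideal dagger_ideal_closed.
HB.instance Definition _ :=
  isPrimeIdealrClosed.Build ringS dagger_ideal dagger_ideal_prime.

Definition Sdag : Type := {ideal_quot dagger_ideal}.
HB.instance Definition _ := NzRingQuotient.on Sdag.
HB.instance Definition _ := GRing.ComNzRing.on Sdag.

Definition Sdag_unit : {pred Sdag} := fun x => `[< exists y, y * x == 1 >].
Definition Sdag_inv (x : Sdag) : Sdag :=
  if pselect (exists y, y * x == 1) is left e then xchoose e else x.

Lemma Sdag_mulVx : {in Sdag_unit, left_inverse 1 Sdag_inv *%R}.
Proof.
move=> x /asboolP ex; rewrite /Sdag_inv; case: pselect => // e.
exact/eqP/(xchooseP e).
Qed.

Lemma Sdag_unitPl x y : y * x = 1 -> x \in Sdag_unit.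
Proof. by move=> yx; apply/asboolP; exists y; apply/eqP. Qed.

Lemma Sdag_inv_out : {in [predC Sdag_unit], Sdag_inv =1 id}.
Proof.
by move=> x /asboolPn nex; rewrite /Sdag_inv; case: pselect => // /nex.
Qed.

HB.instance Definition _ := GRing.ComNzRing_hasMulInverse.Build Sdag
  Sdag_mulVx Sdag_unitPl Sdag_inv_out.

Lemma Sdag_integral : GRing.integral_domain_axiom Sdag.
Proof. exact: (@Quotient.rquot_IdomainAxiom ringS dagger_ideal). Qed.

HB.instance Definition _ := GRing.ComUnitRing_isIntegral.Build Sdag Sdag_integral.

Notation Kdag := {fraction Sdag}.

Definition R_to_Sdag : ringR -> Sdag := \pi_Sdag \o R_to_S.
HB.instance Definition _ := GRing.RMorphism.on R_to_Sdag.

Definition Sdag_to_Kdag : Sdag -> Kdag := @FracField.tofrac Sdag.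
HB.instance Definition _ := GRing.RMorphism.on Sdag_to_Kdag.

(* [mpoly] hides this notation of [monalg]. *)
Local Notation "x @_ g" := (monalg.mcoeff g x) : ring_scope.

Inductive zspan (V : zmodType) (X : V -> Prop) : V -> Prop :=
| zspan0 : zspan X 0
| zspanB x y : zspan X x -> zspan X y -> zspan X (x - y)
| zspan_gen x : X x -> zspan X x.

Definition zspanb (V : zmodType) (X : V -> Prop) : {pred V} :=
  fun v => `[< zspan X v >].

Section ZSpan.
Variables (V : zmodType) (X : V -> Prop).

Lemma zspanbP v : reflect (zspan X v) (v \in zspanb X).
Proof. exact: asboolP. Qed.

Lemma zspanb_closed : zmod_closed (zspanb X).
Proof.
split=> [|x y /zspanbP Xx /zspanbP Xy]; apply/zspanbP; first exact: zspan0.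
exact: zspanB.
Qed.

HB.instance Definition _ := GRing.isZmodClosed.Build V (zspanb X) zspanb_closed.

Lemma zspan_morph (W : zmodType) (Y : W -> Prop) (f : V -> W) :
  {morph f : x y / x - y} -> (forall x, X x -> zspan Y (f x)) ->
  forall v, zspan X v -> zspan Y (f v).
Proof.
move=> fB XY v; elim=> [|x y _ IHx _ IHy|x /XY//]; last by rewrite fB; apply: zspanB.
by rewrite -[0](subrr 0) fB subrr; apply: zspan0.
Qed.

Local Notation Q := (Quotient.quot (zspanb X)).

Lemma eq_quotP (x y : V) : \pi_Q x = \pi y <-> zspan X (x - y).
Proof.
split=> [/eqP|/zspanbP]; first by rewrite -Quotient.idealrBE => /zspanbP.
by rewrite Quotient.idealrBE => /eqP.
Qed.

Lemma pi_reprB (x : V) : zspan X (repr (\pi_Q x) - x).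
Proof. by apply/eq_quotP; rewrite reprK. Qed.

Lemma pi_zspanD (x y : V) : \pi_Q (x + y) = \pi x + \pi y.
Proof. by rewrite !piE. Qed.

Lemma pi_zspanB (x y : V) : \pi_Q (x - y) = \pi x - \pi y.
Proof. by rewrite !piE. Qed.

End ZSpan.

Section AlgQuot.
Variables (R : comNzRingType) (A : algType R) (X : A -> Prop).

(* The two-sided ideal generated by [X] is the additive subgroup generated by
   these products; it is automatically an R-submodule. *)
Inductive ideal_gen : A -> Prop :=
| IdealGen l r m : X r -> ideal_gen (l * r * m).

Definition algquot : Type := Quotient.quot (zspanb ideal_gen).

HB.instance Definition _ := ZmodQuotient.on algquot.

Lemma zspan_idealMl u v : zspan ideal_gen v -> zspan ideal_gen (u * v).
Proof.
apply: (zspan_morph (mulrBr u)) => _ [l r m Xr] /=.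
by rewrite !mulrA; apply/zspan_gen/IdealGen.
Qed.

Lemma zspan_idealMr u v : zspan ideal_gen v -> zspan ideal_gen (v * u).
Proof.
apply: (zspan_morph (fun x y => mulrBl u x y)) => _ [l r m Xr] /=.
by rewrite -!mulrA mulrA; apply/zspan_gen/IdealGen.
Qed.

Definition algquot_scale (c : R) (x : algquot) : algquot := \pi_algquot (c *: repr x).
Definition algquot_mul (x y : algquot) : algquot := \pi_algquot (repr x * repr y).

Lemma pi_algquot_scale c (u : A) :
  algquot_scale c (\pi u) = \pi_algquot (c *: u).
Proof.
apply/eq_quotP; rewrite -scalerBr -mulr_algl.
exact/zspan_idealMl/pi_reprB.
Qed.

Lemma pi_algquot_mul (u v : A) :
  algquot_mul (\pi u) (\pi v) = \pi_algquot (u * v).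
Proof.
apply/eq_quotP; set u' := repr _; set v' := repr _.
have -> : u' * v' - u * v = (u' - u) * v' - u * (v - v').
  by rewrite mulrBl mulrBr opprB addrA subrK.
apply: zspanB; first exact/zspan_idealMr/pi_reprB.
apply: zspan_idealMl; rewrite -opprB -sub0r; apply: zspanB; first exact: zspan0.
exact: pi_reprB.
Qed.

Lemma pi_algquotD (u v : A) : \pi_algquot (u + v) = \pi_algquot u + \pi_algquot v.
Proof. exact (pi_zspanD _ u v). Qed.

Lemma algquot_scaleA a b v :
  algquot_scale a (algquot_scale b v) = algquot_scale (a * b) v.
Proof. by rewrite -[v]reprK (pi_algquot_scale b) !pi_algquot_scale scalerA. Qed.

Lemma algquot_scale1 : left_id 1 algquot_scale.
Proof. by move=> v; rewrite -[v]reprK pi_algquot_scale scale1r. Qed.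

Lemma algquot_scaleDr : right_distributive algquot_scale +%R.
Proof.
move=> c u v; rewrite -[u]reprK -[v]reprK -pi_algquotD !pi_algquot_scale.
by rewrite scalerDr pi_algquotD.
Qed.

Lemma algquot_scaleDl v : {morph algquot_scale^~ v : a b / a + b}.
Proof.
by move=> a b; rewrite -[v]reprK !pi_algquot_scale scalerDl pi_algquotD.
Qed.

HB.instance Definition _ := GRing.Zmodule_isLmodule.Build R algquot
  algquot_scaleA algquot_scale1 algquot_scaleDr algquot_scaleDl.

Lemma algquot_mulA : associative algquot_mul.
Proof.
move=> x y z; rewrite -[x]reprK -[y]reprK -[z]reprK.
by rewrite (pi_algquot_mul (repr y)) (pi_algquot_mul (repr x) (repr y)) !pi_algquot_mul mulrA.
Qed.

Lemma algquot_mul1l : left_id (\pi 1) algquot_mul.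
Proof. by move=> x; rewrite -[x]reprK pi_algquot_mul mul1r. Qed.

Lemma algquot_mul1r : right_id (\pi 1) algquot_mul.
Proof. by move=> x; rewrite -[x]reprK pi_algquot_mul mulr1. Qed.

Lemma algquot_mulDl : left_distributive algquot_mul +%R.
Proof.
move=> x y z; rewrite -[x]reprK -[y]reprK -[z]reprK.
by rewrite -pi_algquotD !pi_algquot_mul mulrDl pi_algquotD.
Qed.

Lemma algquot_mulDr : right_distributive algquot_mul +%R.
Proof.
move=> x y z; rewrite -[x]reprK -[y]reprK -[z]reprK.
by rewrite -pi_algquotD !pi_algquot_mul mulrDr pi_algquotD.
Qed.

HB.instance Definition _ := GRing.Zmodule_isPzRing.Build algquot
  algquot_mulA algquot_mul1l algquot_mul1r algquot_mulDl algquot_mulDr.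

End AlgQuot.

Section GroupAlgebra.
Variables (R : comNzRingType) (G : groupType).

Definition grpalg : Type := {malg R[G]}.
HB.instance Definition _ := GRing.Lmodule.on grpalg.
Implicit Types x y z : grpalg.

Definition grpelt (g : G) : grpalg := << 1 *g g >>.

Definition grpalg_mul x y : grpalg :=
  \sum_(g <- msupp x) \sum_(h <- msupp y) << x@_g * y@_h *g (g * h)%g >>.

Lemma grpalg_mulEw (d1 d2 : {fset G}) x y :
  (msupp x `<=` d1)%fset -> (msupp y `<=` d2)%fset ->
  grpalg_mul x y = \sum_(g <- d1) \sum_(h <- d2) << x@_g * y@_h *g (g * h)%g >>.
Proof.
move=> le1 le2; rewrite /grpalg_mul (big_fset_incl _ le1) /=.
  apply/eq_bigr=> g _; apply/big_fset_incl => // h _ /mcoeff_outdom ->.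
  by rewrite mulr0 monalgU0.
move=> g _ /mcoeff_outdom xg0.
by rewrite big1 // => h _; rewrite xg0 mul0r monalgU0.
Qed.

Lemma grpalg_mulDl : left_distributive grpalg_mul +%R.
Proof.
move=> x y z; have le := fsubset_refl (msupp z).
rewrite (grpalg_mulEw (msuppD_le x y) le) (grpalg_mulEw (fsubsetUl _ (msupp y)) le).
rewrite (grpalg_mulEw (fsubsetUr (msupp x) _) le).
rewrite -big_split /=; apply/eq_bigr=> g _; rewrite -big_split /=.
by apply/eq_bigr=> h _; rewrite mcoeffD mulrDl monalgUD.
Qed.

Lemma grpalg_mulDr : right_distributive grpalg_mul +%R.
Proof.
move=> z x y; have le := fsubset_refl (msupp z).
rewrite (grpalg_mulEw le (msuppD_le x y)) (grpalg_mulEw le (fsubsetUl _ (msupp y))).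
rewrite (grpalg_mulEw le (fsubsetUr (msupp x) _)).
rewrite -big_split /=; apply/eq_bigr=> g _; rewrite -big_split /=.
by apply/eq_bigr=> h _; rewrite mcoeffD mulrDr monalgUD.
Qed.

Lemma grpalg_mul0l : left_zero 0 grpalg_mul.
Proof. by move=> x; rewrite /grpalg_mul msupp0 big_seq_fset0. Qed.

Lemma grpalg_mul0r : right_zero 0 grpalg_mul.
Proof.
by move=> x; rewrite /grpalg_mul big1 // => g _; rewrite msupp0 big_seq_fset0.
Qed.

Lemma grpalg_mulUU c d (g h : G) :
  grpalg_mul << c *g g >> << d *g h >> = << c * d *g (g * h)%g >>.
Proof. by rewrite (grpalg_mulEw msuppU_le msuppU_le) !big_seq_fset1 !mcoeffUU. Qed.

Lemma grpalg_suml I r (P : pred I) (F : I -> grpalg) y :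
  grpalg_mul (\sum_(i <- r | P i) F i) y = \sum_(i <- r | P i) grpalg_mul (F i) y.
Proof.
exact: (big_morph (grpalg_mul^~ y) (fun _ _ => grpalg_mulDl _ _ _) (grpalg_mul0l y)).
Qed.

Lemma grpalg_sumr I r (P : pred I) (F : I -> grpalg) x :
  grpalg_mul x (\sum_(i <- r | P i) F i) = \sum_(i <- r | P i) grpalg_mul x (F i).
Proof.
exact: (big_morph (grpalg_mul x) (fun _ _ => grpalg_mulDr _ _ _) (grpalg_mul0r x)).
Qed.

Lemma grpalg_ind (P : grpalg -> Prop) :
  P 0 -> (forall x y, P x -> P y -> P (x + y)) -> (forall c g, P << c *g g >>) ->
  forall x, P x.
Proof.
move=> P0 PD PU x; rewrite [x]monalgE.
by elim/big_rec: _ => // g y _ Py; apply: PD.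
Qed.

Lemma grpalg_mulA : associative grpalg_mul.
Proof.
elim/grpalg_ind=> [y z|x x' IHx IHx' y z|c g].
- by rewrite !grpalg_mul0l.
- by rewrite !grpalg_mulDl IHx IHx'.
elim/grpalg_ind=> [z|y y' IHy IHy' z|d h].
- by rewrite grpalg_mul0r !grpalg_mul0l grpalg_mul0r.
- by rewrite grpalg_mulDl !grpalg_mulDr !grpalg_mulDl IHy IHy'.
elim/grpalg_ind=> [|z z' IHz IHz'|e k].
- by rewrite !grpalg_mul0r.
- by rewrite !grpalg_mulDr IHz IHz'.
by rewrite !grpalg_mulUU mulrA mulgA.
Qed.

Lemma grpalg_mul1l : left_id (grpelt 1%g) grpalg_mul.
Proof.
elim/grpalg_ind=> [|x y IHx IHy|c g]; first exact: grpalg_mul0r.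
  by rewrite grpalg_mulDr IHx IHy.
by rewrite grpalg_mulUU mul1r mul1g.
Qed.

Lemma grpalg_mul1r : right_id (grpelt 1%g) grpalg_mul.
Proof.
elim/grpalg_ind=> [|x y IHx IHy|c g]; first exact: grpalg_mul0l.
  by rewrite grpalg_mulDl IHx IHy.
by rewrite grpalg_mulUU mulr1 mulg1.
Qed.

Lemma grpelt1_neq0 : grpelt 1%g != 0.
Proof. by rewrite monalgU_eq0 oner_eq0. Qed.

HB.instance Definition _ := GRing.Zmodule_isNzRing.Build grpalg
  grpalg_mulA grpalg_mul1l grpalg_mul1r grpalg_mulDl grpalg_mulDr grpelt1_neq0.

Lemma grpalg_scaleU a c (g : G) : a *: (<< c *g g >> : grpalg) = << a * c *g g >>.
Proof.
by apply/malgP=> h; rewrite mcoeffZ !mcoeffU -mulrnAr.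
Qed.

Lemma grpalg_scaleAl (a : R) x y : a *: (x * y) = (a *: x) * y.
Proof.
elim/grpalg_ind: x => [|x x' IHx IHx'|c g].
- by rewrite scaler0 mul0r scaler0.
- by rewrite scalerDr !mulrDl scalerDr IHx IHx'.
elim/grpalg_ind: y => [|y y' IHy IHy'|d h].
- by rewrite !mulr0 scaler0.
- by rewrite !mulrDr scalerDr IHy IHy'.
by rewrite [_ * _]grpalg_mulUU !grpalg_scaleU [RHS]grpalg_mulUU mulrA.
Qed.

Lemma grpalg_scaleAr (a : R) x y : a *: (x * y) = x * (a *: y).
Proof.
elim/grpalg_ind: x => [|x x' IHx IHx'|c g].
- by rewrite !mul0r scaler0.
- by rewrite !mulrDl scalerDr IHx IHx'.
elim/grpalg_ind: y => [|y y' IHy IHy'|d h].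
- by rewrite scaler0 !mulr0 scaler0.
- by rewrite scalerDr !mulrDr scalerDr IHy IHy'.
by rewrite [_ * _]grpalg_mulUU !grpalg_scaleU [RHS]grpalg_mulUU mulrCA.
Qed.

HB.instance Definition _ := GRing.Lmodule_isLalgebra.Build R grpalg grpalg_scaleAl.
HB.instance Definition _ := GRing.Lalgebra_isAlgebra.Build R grpalg grpalg_scaleAr.

End GroupAlgebra.

Section BaseChange.
Variables (R A : comNzRingType) (f : {rmorphism R -> A}) (M : lmodType R).

Local Notation free := {malg int[(M * A)%type]}.
Local Notation "m ⊠ a" := (<< 1 *g (m, a) >> : free) (at level 40).

(* M ⊗_R A is the free abelian group on M × A modulo R-balanced biadditivity;
   A acts through the right-hand factor. *)
Inductive tensor_rel : free -> Prop :=
| TensorDl m m' a : tensor_rel ((m + m') ⊠ a - m ⊠ a - m' ⊠ a)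
| TensorDr m a a' : tensor_rel (m ⊠ (a + a') - m ⊠ a - m ⊠ a')
| TensorZ r m a : tensor_rel ((r *: m) ⊠ a - m ⊠ (f r * a)).

Definition base_change : Type := Quotient.quot (zspanb tensor_rel).

HB.instance Definition _ := ZmodQuotient.on base_change.

Definition free_act (c : A) (x : free) : free :=
  \sum_(k <- msupp x) << x@_k *g (k.1, c * k.2) >>.

Lemma free_actEw c (d : {fset (M * A)%type}) x : (msupp x `<=` d)%fset ->
  free_act c x = \sum_(k <- d) << x@_k *g (k.1, c * k.2) >>.
Proof.
move=> le; rewrite /free_act (big_fset_incl _ le) //= => k _ /mcoeff_outdom ->.
by rewrite monalgU0.
Qed.

Lemma free_actU c n m a : free_act c << n *g (m, a) >> = << n *g (m, c * a) >>.
Proof. by rewrite (free_actEw _ msuppU_le) big_seq_fset1 mcoeffUU. Qed.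

Lemma free_act_additive c : zmod_morphism (free_act c).
Proof.
move=> x y; rewrite (free_actEw _ (msuppB_le x y)).
rewrite (free_actEw _ (fsubsetUl _ (msupp y))).
rewrite (free_actEw _ (fsubsetUr (msupp x) _)) -sumrB.
by apply/eq_bigr=> k _; rewrite mcoeffB monalgUB.
Qed.

HB.instance Definition _ c :=
  GRing.isZmodMorphism.Build free free (free_act c) (free_act_additive c).

Lemma free_act_zspan c v : zspan tensor_rel v -> zspan tensor_rel (free_act c v).
Proof.
apply: (zspan_morph (raddfB (free_act c))) => _ [m m' a|m a a'|r m a];
  rewrite !raddfB /= !free_actU; apply: zspan_gen.
- exact: TensorDl.
- by rewrite mulrDr; apply: TensorDr.
- by rewrite mulrCA; apply: TensorZ.
Qed.

Lemma free_ind (P : free -> Prop) :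
  P 0 -> (forall x y, P x -> P y -> P (x - y)) -> (forall m a, P (m ⊠ a)) ->
  forall x, P x.
Proof.
move=> P0 PB PU x.
have PN y : P y -> P (- y) by move=> Py; rewrite -sub0r; apply: PB.
have PD y z : P y -> P z -> P (y + z).
  by move=> Py Pz; rewrite -[z]opprK; apply: PB => //; apply: PN.
rewrite [x]monalgE; elim/big_rec: _ => // -[m a] y _ Py; apply: (PD) => //.
have PnatU n : P << n%:Z *g (m, a) >>.
  by elim: n => [|n IHn]; rewrite ?monalgU0 // -addn1 PoszD monalgUD; apply: PD.
by case: (x@_(m, a)) => n //; rewrite NegzE monalgUN; apply: PN.
Qed.

Definition bc_scale (c : A) (x : base_change) : base_change :=
  \pi_base_change (free_act c (repr x)).

Lemma pi_bc_scale c u : bc_scale c (\pi u) = \pi_base_change (free_act c u).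
Proof. by apply/eq_quotP; rewrite -raddfB; apply/free_act_zspan/pi_reprB. Qed.

Lemma pi_bcD (u v : free) : \pi_base_change (u + v) = \pi_base_change u + \pi_base_change v.
Proof. exact (pi_zspanD _ u v). Qed.

Lemma pi_bcB (u v : free) : \pi_base_change (u - v) = \pi_base_change u - \pi_base_change v.
Proof. exact (pi_zspanB _ u v). Qed.

Lemma bc_scaleA c d v : bc_scale c (bc_scale d v) = bc_scale (c * d) v.
Proof.
rewrite -[v]reprK (pi_bc_scale d) !pi_bc_scale; congr (\pi _).
elim/free_ind: (repr v) => [|x y|m a].
- by rewrite !raddf0.
- by rewrite !raddfB /= => -> ->.
- by rewrite !free_actU mulrA.
Qed.

Lemma bc_scale1 : left_id 1 bc_scale.
Proof.
move=> v; rewrite -[v]reprK pi_bc_scale; congr (\pi _).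
elim/free_ind: (repr v) => [|x y|m a]; first by rewrite raddf0.
  by rewrite raddfB /= => -> ->.
by rewrite free_actU mul1r.
Qed.

Lemma bc_scaleDr : right_distributive bc_scale +%R.
Proof.
move=> c u v; rewrite -[u]reprK -[v]reprK -pi_bcD !pi_bc_scale.
by rewrite raddfD pi_bcD.
Qed.

Lemma bc_scaleDl v : {morph bc_scale^~ v : c d / c + d}.
Proof.
move=> c d; rewrite -[v]reprK !pi_bc_scale.
elim/free_ind: (repr v) => [|x y IHx IHy|m a].
- by rewrite !raddf0 addr0.
- by rewrite !raddfB /= IHx IHy opprD addrACA.
rewrite !free_actU mulrDl -pi_bcD; apply/eq_quotP.
by rewrite opprD addrA; apply/zspan_gen/TensorDr.
Qed.

HB.instance Definition _ := GRing.Zmodule_isLmodule.Build A base_change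
  bc_scaleA bc_scale1 bc_scaleDr bc_scaleDl.

End BaseChange.

(* A letter [(i, true)] is the generator s_(i+1), [(i, false)] its inverse. *)
Definition letter : Type := ('I_2 * bool)%type.

Inductive braid_eq : seq letter -> seq letter -> Prop :=
| braid_refl u : braid_eq u u
| braid_sym u v : braid_eq u v -> braid_eq v u
| braid_trans u v w : braid_eq u v -> braid_eq v w -> braid_eq u w
| braid_cat u u' v v' : braid_eq u u' -> braid_eq v v' -> braid_eq (u ++ v) (u' ++ v')
| braid_cancel i e : braid_eq [:: (i, e); (i, ~~ e)] [::]
| braid_artin : braid_eq [:: (ord0, true); (ord_max, true); (ord0, true)]
                         [:: (ord_max, true); (ord0, true); (ord_max, true)].

Definition braid_eqb (u v : seq letter) : bool := `[< braid_eq u v >].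

Lemma braid_eqb_equiv : equiv_class_of braid_eqb.
Proof.
split=> [u|u v|v u w]; first exact/asboolP/braid_refl.
  by apply: asbool_equiv_eq; split=> /braid_sym.
move=> /asboolP uv /asboolP vw; apply/asboolP; exact: braid_trans uv vw.
Qed.

Canonical braid_equiv := EquivRelPack braid_eqb_equiv.

Definition braid3 : Type := {eq_quot braid_equiv}.
HB.instance Definition _ := EqQuotient.on braid3.
HB.instance Definition _ := Choice.on braid3.

Lemma eq_braidP (u v : seq letter) : \pi_braid3 u = \pi_braid3 v <-> braid_eq u v.
Proof. by split=> [/eqmodP/asboolP|/asboolP uv]; last exact/eqmodP. Qed.

Lemma braid_repr (u : seq letter) : braid_eq (repr (\pi_braid3 u)) u.
Proof. by apply/eq_braidP; rewrite reprK. Qed.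

Definition word_inv (u : seq letter) : seq letter := rev [seq (l.1, ~~ l.2) | l <- u].

Definition braid_mul (x y : braid3) : braid3 := \pi_braid3 (repr x ++ repr y).
Definition braid_one : braid3 := \pi_braid3 [::].
Definition braid_inv (x : braid3) : braid3 := \pi_braid3 (word_inv (repr x)).

Lemma pi_braid_mul (u v : seq letter) :
  braid_mul (\pi_braid3 u) (\pi_braid3 v) = \pi_braid3 (u ++ v).
Proof. by apply/eq_braidP/braid_cat; apply: braid_repr. Qed.

Lemma braid_mulA : associative braid_mul.
Proof.
move=> x y z; rewrite -[x]reprK -[y]reprK -[z]reprK.
rewrite (pi_braid_mul (repr y)) (pi_braid_mul (repr x) (repr y)) !pi_braid_mul.
by rewrite catA.
Qed.

Lemma braid_mul1l : left_id braid_one braid_mul.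
Proof. by move=> x; rewrite -[x]reprK pi_braid_mul. Qed.

Lemma braid_mul1r : right_id braid_one braid_mul.
Proof. by move=> x; rewrite -[x]reprK pi_braid_mul cats0. Qed.

Lemma word_invK : involutive word_inv.
Proof.
move=> u; rewrite /word_inv map_rev revK -map_comp map_id_in // => -[i e] _ /=.
by rewrite negbK.
Qed.

Lemma word_catV u : braid_eq (u ++ word_inv u) [::].
Proof.
elim: u => [|[i e] u IHu]; first exact: braid_refl.
rewrite /word_inv /= rev_cons -cats1 catA -cat_cons -cat1s.
apply: braid_trans (braid_cancel i e).
rewrite -[X in braid_eq _ X]/([:: (i, e)] ++ [::] ++ [:: (i, ~~ e)]) -catA.
by apply: braid_cat; [exact: braid_refl | apply: braid_cat; [|exact: braid_refl]].
Qed.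

Lemma braid_mulV : right_inverse braid_one braid_inv braid_mul.
Proof.
move=> x; rewrite -{1}[x]reprK pi_braid_mul; apply/eq_braidP.
exact: word_catV.
Qed.

Lemma braid_mulVl : left_inverse braid_one braid_inv braid_mul.
Proof.
move=> x; rewrite -{2}[x]reprK pi_braid_mul; apply/eq_braidP.
by rewrite -[X in _ ++ X]word_invK; apply: word_catV.
Qed.

HB.instance Definition _ := isGroup.Build braid3
  braid_mulA braid_mul1l braid_mul1r braid_mulVl braid_mulV.

Definition sigma (i : 'I_2) : braid3 := \pi_braid3 [:: (i, true)].

Section BMW.
Local Notation RB3 := (grpalg ringR braid3).
Local Notation s1 := (sigma ord0).
Local Notation s2 := (sigma ord_max).
Local Notation "[ g ]" := (grpelt ringR (g)%g : RB3).

Inductive bmw_rel : RB3 -> Prop :=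
| BmwCubic i : bmw_rel
    (([sigma i] - aR%:A) * ([sigma i] - bR%:A) * ([sigma i] - cR%:A))
| BmwSkein : bmw_rel
    (- yR *: [s1 * s2^-1 * s1] + yR ^+ 2 *: [s2^-1 * s1 * s2^-1]
     - [s1 * s2 * s1] - (xR * yR ^+ 2) *: [s2 ^- 2] + xR *: [s1 ^+ 2]
     + yR ^+ 3 *: [s2^-1 * s1^-1 * s2^-1]).

Definition BMW : Type := algquot bmw_rel.
HB.instance Definition _ := GRing.PzRing.on BMW.
HB.instance Definition _ := GRing.Lmodule.on BMW.

End BMW.

Definition BMWdag : Type := base_change R_to_Sdag BMW.
HB.instance Definition _ := GRing.Lmodule.on BMWdag.

Definition BMWdagK : Type := base_change Sdag_to_Kdag BMWdag.
HB.instance Definition _ := GRing.Lmodule.on BMWdagK.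

(* Main.v *)
(* Write x = b + c, y = b c, e_i for the product of the s1 - l_j over the two
   parameters l_j other than l_i (where l = (a, b, c)), and u_i = s_i - x + y s_i^-1.
   The braid relation turns the skein relation into s1 u2 s1 = y^2 s2^-1 u1 s2^-1,
   equivalently u1 s2 s1^2 = y^2 u1 s2^-1 and s1^2 s2 u1 = y^2 s2^-1 u1. Since e_0 is a
   multiple of u1, these two identities express e_0 s2^-1 e_j and e_j s2^-1 e_0 through
   e_0 s2 e_j and e_j s2 e_0.
   Hence the sixteen elements e_i s2 e_j (nine), e_i s2^-1 e_j with i, j among the indices
   of b and c (four) and e_i (three) span: their span is stable under left multiplication
   by s1 and s2^-1, and the cubic relation then yields stability under s1^-1 and s2.
   They are independent because three scalar representations (a scalar a is allowed
   precisely because a^4 = y^2), a 2-dimensional one with eigenvalues b, c and a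
   3-dimensional one with eigenvalues a, b, c, all with s1 diagonal, separate them:
   3 + 4 + 9 = 16. *)
Require Import Defs.
From HB Require Import structures.
From mathcomp Require Import all_boot all_algebra ssrAC.
From mathcomp Require Import generic_quotient ring_quotient fraction.
From mathcomp Require Import ring boolp finmap.
From mathcomp Require Import mpoly monalg.

Set Implicit Arguments.
Unset Strict Implicit.
Unset Printing Implicit Defensive.

Import GRing.Theory.
Local Open Scope ring_scope.
Local Open Scope quotient_scope.

(** * Universal properties of base change, group algebras and quotients *)

Section MalgLift.
Variables (T : choiceType) (G V : zmodType) (F : T -> {additive G -> V}).
Implicit Types x y : {malg G[T]}.

(** One construction serves twice: with integer coefficients it maps out of the free group that
    presents a tensor product, with coefficients in [R] out of a group algebra. *)
Definition malg_lift x : V := \sum_(k <- msupp x) F k (monalg.mcoeff k x).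

Lemma malg_liftEw (d : {fset T}) x : (msupp x `<=` d)%fset ->
  malg_lift x = \sum_(k <- d) F k (monalg.mcoeff k x).
Proof.
move=> le; rewrite /malg_lift (big_fset_incl _ le) //= => k _ /mcoeff_outdom ->.
by rewrite raddf0.
Qed.

Lemma malg_lift_additive : zmod_morphism malg_lift.
Proof.
move=> x y; rewrite (malg_liftEw (msuppB_le x y)).
rewrite (malg_liftEw (fsubsetUl _ (msupp y))).
rewrite (malg_liftEw (fsubsetUr (msupp x) _)) -sumrB.
by apply/eq_bigr=> k _; rewrite mcoeffB raddfB.
Qed.

HB.instance Definition _ :=
  GRing.isZmodMorphism.Build {malg G[T]} V malg_lift malg_lift_additive.

Lemma malg_liftU c k : malg_lift << c *g k >> = F k c.
Proof. by rewrite (malg_liftEw msuppU_le) big_seq_fset1 mcoeffUU. Qed.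

End MalgLift.

Section ZSpanLift.
Variables (V W : zmodType) (X : V -> Prop) (g : {additive V -> W}).

Lemma zspan_ker : (forall x, X x -> g x = 0) -> forall x, zspan X x -> g x = 0.
Proof.
move=> gX x; elim=> [|y z _ gy _ gz|y /gX//]; first exact: raddf0.
by rewrite raddfB gy gz subrr.
Qed.
End ZSpanLift.

(** * The universal property of the tensor product, for one and for two base changes *)

Section BaseChangeLift.
Variables (R A : comNzRingType) (f : {rmorphism R -> A}) (M : lmodType R).
Variables (K : comNzRingType) (h : {rmorphism A -> K}) (V : lmodType K).

(** The canonical map sending m to m tensor 1. *)
Definition bc_in (m : M) : base_change f M := \pi_(base_change f M) << 1 *g (m, 1) >>.

Lemma bc_in_scale c m : c *: bc_in m = \pi_(base_change f M) << 1 *g (m, c) >>.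
Proof. by rewrite [LHS](pi_bc_scale f) free_actU mulr1. Qed.

Lemma bc_in_linear r m m' : bc_in (r *: m + m') = f r *: bc_in m + bc_in m'.
Proof.
rewrite bc_in_scale -(pi_bcD f); apply/eq_quotP.
set u := << _ *g (r *: m + _, _) >>; set p := << _ *g (m, _) >>; set q := << _ >>.
have -> : u - (p + q) = (u - << 1 *g (r *: m, 1) >> - q) + (<< 1 *g (r *: m, 1) >> - p).
  by rewrite addrACA subrK -opprD (addrC q).
apply/zspanbP/rpredD; apply/zspanbP/zspan_gen; first exact: TensorDl.
by rewrite /p -[f r]mulr1; apply: TensorZ.
Qed.

Lemma bc_ind (P : base_change f M -> Prop) :
  (forall x y, P x -> P y -> P (x - y)) -> (forall c m, P (c *: bc_in m)) ->
  forall x, P x.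
Proof.
move=> PB PU x; rewrite -[x]reprK; elim/free_ind: (repr x) => [|u v Pu Pv|m a].
- have P0 := PB _ _ (PU 1 0) (PU 1 0); rewrite subrr in P0.
  by have := pi_bcB f (0 : {malg int[(M * A)%type]}) 0; rewrite !subrr => ->.
- by rewrite (pi_bcB f); apply: PB.
by rewrite -bc_in_scale.
Qed.

(** Sending m tensor a to h(a) phi(m) is biadditive and balanced, so it descends to the quotient.
    The target is a module over a further ring [K], which allows extension to the middle ring of a
    tower while staying in a vector space over the top one. *)
Lemma bc_lift (phi : M -> V) :
  (forall r m m', phi (r *: m + m') = h (f r) *: phi m + phi m') ->
  exists2 g : base_change f M -> V,
    forall c x y, g (c *: x + y) = h c *: g x + g y & forall m, g (bc_in m) = phi m.
Proof.
move=> phiL.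
have phiD m m' : phi (m + m') = phi m + phi m'.
  by rewrite -[m]scale1r phiL !rmorph1 !scale1r.
have phi0 : phi 0 = 0.
  by apply: (addrI (phi 0)); rewrite -phiD !addr0.
have phiZ r m : phi (r *: m) = h (f r) *: phi m.
  by rewrite -[r *: m]addr0 phiL phi0 addr0.
pose F (k : (M * A)%type) : int -> V := fun n => (h k.2 *: phi k.1) *~ n.
have FB k : zmod_morphism (F k) by move=> m n; rewrite /F mulrzBr.
pose F' k : {additive int -> V} :=
  HB.pack (F k) (GRing.isZmodMorphism.Build int V (F k) (FB k)).
have F'U m a : malg_lift F' << 1 *g (m, a) >> = h a *: phi m by rewrite malg_liftU.
pose g (x : base_change f M) := malg_lift F' (repr x).
have gpi u : g (\pi u) = malg_lift F' u.
  apply/eqP; rewrite -subr_eq0 -raddfB; apply/eqP.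
  apply: zspan_ker (pi_reprB _ u) => _ [m m' a|m a a'|r m a]; rewrite !raddfB /= !F'U.
  - by rewrite phiD scalerDr addrAC addrK subrr.
  - by rewrite rmorphD scalerDl addrAC addrK subrr.
  - by rewrite phiZ scalerA -rmorphM mulrC subrr.
exists g => [c x y|m]; last by rewrite gpi F'U rmorph1 scale1r.
have gB u v : g (u - v) = g u - g v.
  by rewrite -[u]reprK -[v]reprK -(pi_bcB f) !gpi raddfB.
have g0 : g 0 = 0 by have := gB 0 0; rewrite !subrr.
have gD u v : g (u + v) = g u + g v.
  by have := gB u (0 - v); rewrite (gB 0) g0 !sub0r !opprK.
rewrite gD; congr (_ + _); elim/bc_ind: x => [u v gu gv|d m].
  by rewrite scalerBr !gB gu gv scalerBr.
by rewrite scalerA !bc_in_scale !gpi !F'U rmorphM scalerA.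
Qed.

End BaseChangeLift.

Section Tower.
Variables (R A K : comNzRingType) (f : R -> A) (h : {rmorphism A -> K}).
Variables (M : lmodType R) (N : lmodType A) (V : lmodType K) (i : M -> N) (j : N -> V).
Hypothesis i_linear : forall r x y, i (r *: x + y) = f r *: i x + i y.
Hypothesis j_linear : forall r x y, j (r *: x + y) = h r *: j x + j y.

Lemma tower_linear r x y : j (i (r *: x + y)) = h (f r) *: j (i x) + j (i y).
Proof. by rewrite i_linear j_linear. Qed.

(** Expanding n in elements c i(m) turns k j(n) into combinations of j(i(m)), because j is
    semilinear. With [tower_lift], two successive base changes can be used as a single one. *)
Lemma tower_ind :
  (forall Q : N -> Prop, (forall x y, Q x -> Q y -> Q (x - y)) ->
    (forall c m, Q (c *: i m)) -> forall x, Q x) ->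
  (forall Q : V -> Prop, (forall x y, Q x -> Q y -> Q (x - y)) ->
    (forall k n, Q (k *: j n)) -> forall x, Q x) ->
  forall Q : V -> Prop, (forall x y, Q x -> Q y -> Q (x - y)) ->
    (forall k m, Q (k *: j (i m))) -> forall x, Q x.
Proof.
move=> i_gen j_gen Q QB QZ; apply: j_gen => // k n.
have jB x y : j (x - y) = j x - j y.
  by rewrite addrC -scaleN1r j_linear rmorphN1 scaleN1r addrC.
have j0 : j 0 = 0 by rewrite -(subrr 0) jB subrr.
elim/i_gen: n k => [x y Qx Qy k|c m k]; first by rewrite jB scalerBr; apply: QB.
by rewrite -[_ *: i m]addr0 j_linear j0 addr0 scalerA.
Qed.

Lemma tower_lift (W : lmodType K) :
  (forall phi : M -> W, (forall r x y, phi (r *: x + y) = h (f r) *: phi x + phi y) ->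
    exists2 g : N -> W, forall c x y, g (c *: x + y) = h c *: g x + g y
      & forall m, g (i m) = phi m) ->
  (forall phi : N -> W, (forall r x y, phi (r *: x + y) = h r *: phi x + phi y) ->
    exists2 g : V -> W, forall k x y, g (k *: x + y) = k *: g x + g y
      & forall n, g (j n) = phi n) ->
  forall phi : M -> W, (forall r x y, phi (r *: x + y) = h (f r) *: phi x + phi y) ->
  exists g : {linear V -> W}, forall m, g (j (i m)) = phi m.
Proof.
move=> i_lift j_lift phi /i_lift[g1 /j_lift[g gL gE] g1E].
pose G : {linear V -> W} := HB.pack g (GRing.isLinear.Build K V W _ g gL).
by exists G => m; rewrite /= gE g1E.
Qed.

End Tower.

(** * Homomorphisms out of the group algebra and out of the braid group *)

Section GroupAlgebraLift.
Variables (R K : comNzRingType) (h : {rmorphism R -> K}) (P : algType K).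
Variables (G : groupType) (chi : G -> P).
Hypotheses (chi1 : chi 1%g = 1) (chiM : forall g k, chi (g * k)%g = chi g * chi k).

Definition grpalg_term (g : G) : R -> P := fun c => h c *: chi g.

Lemma grpalg_term_additive g : zmod_morphism (grpalg_term g).
Proof. by move=> c d; rewrite /grpalg_term rmorphB scalerBl. Qed.

HB.instance Definition _ g :=
  GRing.isZmodMorphism.Build R P (grpalg_term g) (grpalg_term_additive g).

Definition grpalg_lift : grpalg R G -> P := malg_lift grpalg_term.
HB.instance Definition _ := GRing.Additive.on grpalg_lift.

Lemma grpalg_liftU c g : grpalg_lift << c *g g >> = h c *: chi g.
Proof. exact: malg_liftU. Qed.

Lemma grpalg_lift_elt g : grpalg_lift (grpelt R g) = chi g.
Proof. by rewrite grpalg_liftU rmorph1 scale1r. Qed.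

Lemma grpalg_lift_is_monoid_morphism : monoid_morphism grpalg_lift.
Proof.
split=> [|x y]; first by rewrite grpalg_lift_elt chi1.
elim/grpalg_ind: x => [|x x' IHx IHx'|c g].
- by rewrite mul0r !raddf0 mul0r.
- by rewrite mulrDl !raddfD /= IHx IHx' mulrDl.
elim/grpalg_ind: y => [|y y' IHy IHy'|d k].
- by rewrite mulr0 !raddf0 mulr0.
- by rewrite mulrDr !raddfD /= IHy IHy' mulrDr.
rewrite [_ * _]grpalg_mulUU !grpalg_liftU chiM rmorphM.
by rewrite -scalerAl -scalerAr scalerA.
Qed.

Lemma grpalg_liftZ c x : grpalg_lift (c *: x) = h c *: grpalg_lift x.
Proof.
elim/grpalg_ind: x => [|x y IHx IHy|d g].
- by rewrite scaler0 raddf0 scaler0.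
- by rewrite scalerDr !raddfD /= IHx IHy.
by rewrite grpalg_scaleU !grpalg_liftU rmorphM scalerA.
Qed.

End GroupAlgebraLift.

Section BraidRepresentation.
Variables (P : nzRingType).
Variables (S T : 'I_2 -> P).
Hypotheses (ST : forall i, S i * T i = 1) (TS : forall i, T i * S i = 1).
Hypothesis braidS : S ord0 * S ord_max * S ord0 = S ord_max * S ord0 * S ord_max.

Definition word_val (u : seq letter) : P := \prod_(l <- u) (if l.2 then S l.1 else T l.1).

Lemma word_val_cat u v : word_val (u ++ v) = word_val u * word_val v.
Proof. exact: big_cat. Qed.

Lemma word_val_braid u v : braid_eq u v -> word_val u = word_val v.
Proof.
elim=> {u v} [//|u v _ //|u v w _ -> //|u u' v v' _ eu _ ev|i [|]|].
- by rewrite !word_val_cat eu ev.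
- by rewrite /word_val !big_cons big_nil /= mulr1.
- by rewrite /word_val !big_cons big_nil /= mulr1.
by rewrite /word_val !big_cons !big_nil /= !mulr1 !mulrA.
Qed.

Definition braid_val (g : braid3) : P := word_val (repr g).

Lemma braid_val_pi u : braid_val (\pi u) = word_val u.
Proof. exact/word_val_braid/braid_repr. Qed.

Lemma braid_valM g k : braid_val (g * k)%g = braid_val g * braid_val k.
Proof. by rewrite [(g * k)%g]/(braid_mul g k) braid_val_pi word_val_cat. Qed.

Lemma braid_val1 : braid_val 1%g = 1.
Proof. by have := braid_val_pi [::]; rewrite /word_val big_nil. Qed.

Lemma braid_val_sigma i : braid_val (sigma i) = S i.
Proof. by rewrite braid_val_pi /word_val big_seq1. Qed.

Lemma braid_val_sigmaV i : braid_val (sigma i)^-1%g = T i.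
Proof.
rewrite -[LHS]mul1r -[1](TS i) -mulrA -{1}braid_val_sigma -braid_valM.
by rewrite mulgV braid_val1 mulr1.
Qed.

End BraidRepresentation.

(** * The quotient algebra and homomorphisms out of it *)

Section AlgQuotScale.
Variables (R : comNzRingType) (A : algType R) (X : A -> Prop).
Implicit Types (c : R) (u v : A) (x y : algquot X).
Local Notation pi := (\pi_(algquot X)).

Lemma algquot_piZ c u : c *: (pi u : algquot X) = pi (c *: u).
Proof. exact: pi_algquot_scale. Qed.

Lemma algquot_piM u v : (pi u : algquot X) * (pi v : algquot X) = pi (u * v).
Proof. exact: pi_algquot_mul. Qed.

Lemma algquot_scaleAl c x y : c *: (x * y) = c *: x * y.
Proof.
by rewrite -[x]reprK -[y]reprK algquot_piM !algquot_piZ algquot_piM scalerAl.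
Qed.

Lemma algquot_scaleAr c x y : c *: (x * y) = x * (c *: y).
Proof.
by rewrite -[x]reprK -[y]reprK algquot_piM !algquot_piZ algquot_piM scalerAr.
Qed.

End AlgQuotScale.

Section AlgQuotLift.
Variables (R K : comNzRingType) (A : algType R) (X : A -> Prop) (P : algType K).
Variables (h : {rmorphism R -> K}) (g : {rmorphism A -> P}).
Hypothesis gZ : forall c x, g (c *: x) = h c *: g x.
Hypothesis gX : forall x, X x -> g x = 0.

Definition algquot_lift (x : algquot X) : P := g (repr x).

Lemma algquot_lift_pi x : algquot_lift (\pi x) = g x.
Proof.
apply/eqP; rewrite -subr_eq0 -raddfB; apply/eqP.
apply: zspan_ker (pi_reprB _ x) => _ [l r m Xr].
by rewrite /= !rmorphM /= (gX Xr) mulr0 mul0r.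
Qed.

Lemma algquot_lift_linear c x y :
  algquot_lift (c *: x + y) = h c *: algquot_lift x + algquot_lift y.
Proof.
rewrite -[x]reprK -[y]reprK algquot_piZ -pi_algquotD.
by rewrite !algquot_lift_pi raddfD /= gZ.
Qed.

Lemma algquot_liftM x y : algquot_lift (x * y) = algquot_lift x * algquot_lift y.
Proof.
by rewrite -[x]reprK -[y]reprK algquot_piM !algquot_lift_pi rmorphM.
Qed.

Lemma algquot_lift1 : algquot_lift 1 = 1.
Proof. by have := algquot_lift_pi 1; rewrite rmorph1. Qed.

End AlgQuotLift.

(** * The algebra BMW_3 and its representations *)

Definition bmw_of : grpalg ringR braid3 -> BMW := \pi_BMW.
Definition bmw_gen (i : 'I_2) : BMW := bmw_of (grpelt ringR (sigma i)).
Definition bmw_genV (i : 'I_2) : BMW := bmw_of (grpelt ringR (sigma i)^-1%g).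

Lemma bmw_ofM x y : bmw_of (x * y) = bmw_of x * bmw_of y.
Proof. exact: esym (algquot_piM bmw_rel x y). Qed.

Lemma bmw_of1 : bmw_of 1 = 1. Proof. by []. Qed.

Section AlgebraImage.
Variables (R K : comNzRingType) (h : {rmorphism R -> K}) (A : algType R) (P : algType K).
Variables (g : {rmorphism A -> P}).
Hypothesis gZ : forall c x, g (c *: x) = h c *: g x.

(** This and [image_skein] are applied both along a change of scalars, to see that a representation
    kills the relators, and along the identity of [ringR], to read the relations off inside
    [BMW]. *)
Lemma image_cubic s a b c : g ((s - a%:A) * (s - b%:A) * (s - c%:A)) =
  (g s - (h a)%:A) * (g s - (h b)%:A) * (g s - (h c)%:A).
Proof. by rewrite !rmorphM !rmorphB /= !gZ !rmorph1. Qed.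

Lemma image_skein x y (w1 w2 w3 w4 w5 w6 : A) :
  g (- y *: w1 + y ^+ 2 *: w2 - w3 - (x * y ^+ 2) *: w4 + x *: w5 + y ^+ 3 *: w6) =
  - h y *: g w1 + h y ^+ 2 *: g w2 - g w3 - (h x * h y ^+ 2) *: g w4 + h x *: g w5
  + h y ^+ 3 *: g w6.
Proof.
rewrite !(rmorphD, rmorphB, rmorphN) /= !gZ.
by rewrite !(rmorphM, rmorphN, rmorphXn).
Qed.

End AlgebraImage.

Definition bmw_representation (K : comNzRingType) (h : ringR -> K) (P : algType K)
    (S T : 'I_2 -> P) (phi : BMW -> P) :=
  [/\ forall c x y, phi (c *: x + y) = h c *: phi x + phi y,
      forall x y, phi (x * y) = phi x * phi y, phi 1 = 1,
      forall i, phi (bmw_gen i) = S i & forall i, phi (bmw_genV i) = T i].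

Section BMWLift.
Variables (K : comNzRingType) (h : {rmorphism ringR -> K}) (P : algType K).
Variables (S T : 'I_2 -> P).
Hypotheses (ST : forall i, S i * T i = 1) (TS : forall i, T i * S i = 1).
Local Notation s1 := (S ord0).
Local Notation s2 := (S ord_max).
Local Notation t1 := (T ord0).
Local Notation t2 := (T ord_max).
Hypothesis braidS : s1 * s2 * s1 = s2 * s1 * s2.
Hypothesis cubicS : forall i,
  (S i - (h aR)%:A) * (S i - (h bR)%:A) * (S i - (h cR)%:A) = 0.
Hypothesis skeinS :
  - h yR *: (s1 * t2 * s1) + h yR ^+ 2 *: (t2 * s1 * t2) - s1 * s2 * s1
  - (h xR * h yR ^+ 2) *: (t2 * t2) + h xR *: (s1 * s1)
  + h yR ^+ 3 *: (t2 * t1 * t2) = 0.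

(** The three layers of the presentation are crossed in turn: words modulo braid equivalence, the
    group algebra, and the quotient, where multiplicativity makes it enough to kill the relators. *)
Lemma bmw_lift : exists phi, bmw_representation h S T phi.
Proof.
pose chi := braid_val S T.
have chi1 : chi 1%g = 1 := braid_val1 ST TS braidS.
have chiM g k : chi (g * k)%g = chi g * chi k := braid_valM ST TS braidS g k.
have chiS i : chi (sigma i) = S i := braid_val_sigma ST TS braidS i.
have chiT i : chi (sigma i)^-1%g = T i := braid_val_sigmaV ST TS braidS i.
pose g : {rmorphism grpalg ringR braid3 -> P} := HB.pack (grpalg_lift h chi)
  (GRing.isMonoidMorphism.Build _ _ (grpalg_lift h chi)
     (grpalg_lift_is_monoid_morphism h chi1 chiM)).
have gZ c x : g (c *: x) = h c *: g x by apply: grpalg_liftZ.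
have gE k : g (grpelt ringR k) = chi k by apply: grpalg_lift_elt.
have gX x : bmw_rel x -> g x = 0.
  case=> [i|].
    apply: etrans (image_cubic gZ (grpelt ringR (sigma i)) aR bR cR) _.
    by rewrite gE chiS cubicS.
  have chiVV : chi (sigma ord_max ^- 2)%g = t2 * t2.
    by rewrite -expVgn expgS expg1 chiM chiT.
  apply: etrans (image_skein gZ xR yR _ _ _ _ _ _) _.
  by rewrite !gE chiVV expgS expg1 !chiM !chiS !chiT skeinS.
exists (algquot_lift g); split=> [|||i|i].
- exact: algquot_lift_linear gZ gX.
- exact: algquot_liftM gX.
- exact: algquot_lift1 gX.
- by rewrite [LHS]algquot_lift_pi // gE.
- by rewrite [LHS]algquot_lift_pi // gE.
Qed.

End BMWLift.

(** When both generators act by v, v^3 times the skein relation factors into the product of the last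
    hypothesis. *)
Lemma bmw_scalar_representation (F : fieldType) (h : {rmorphism ringR -> F}) (v : F) :
  v != 0 -> (v - h aR) * (v - h bR) * (v - h cR) = 0 ->
  (h yR ^+ 2 - v ^+ 4) * (v ^+ 2 - h xR * v + h yR) = 0 ->
  exists phi, bmw_representation h (fun=> v : F^o) (fun=> v^-1 : F^o) phi.
Proof.
move=> v0 cubic skein.
have mulA1 (c : F) : c%:A = c :> F^o by rewrite /GRing.scale /= mulr1.
apply: (bmw_lift (h := h) (P := F^o)).
- by move=> _; rewrite mulfV.
- by move=> _; rewrite mulVf.
- by [].
- by move=> _; rewrite !mulA1.
- rewrite /GRing.scale /=; apply: (mulfI (expf_neq0 3 v0)); rewrite mulr0 -[RHS]skein.
  by move: (h xR) (h yR) => x y; field.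
Qed.

(** Since b is a root of v^2 - x v + y, both generators may act by the scalar b on Q(a,b,c). This
    supplies the nonzero-ring structure declared next. *)
Lemma bmw_oner_neq0 : 1 != 0 :> BMW.
Proof.
pose h : {rmorphism ringR -> Fabc} := (val : ringR -> Fabc).
have b0 : h bR != 0 := bF_neq0.
have yE : h yR = h bR * h cR by [].
have xE : h xR = h bR + h cR by [].
have [||phi [phiL _ phi1 _ _]] := bmw_scalar_representation (h := h) b0.
- by rewrite subrr mulr0 mul0r.
- rewrite yE xE; move: (h bR) (h cR) => u v; ring.
apply/eqP => /(congr1 phi); rewrite phi1 => /eqP.
by have := phiL (-1) 0 0; rewrite rmorphN1 !scaleN1r oppr0 addr0 addNr => ->; rewrite oner_eq0.
Qed.
HB.instance Definition _ := GRing.PzSemiRing_isNonZero.Build BMW bmw_oner_neq0.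
HB.instance Definition _ :=
  GRing.Lmodule_isLalgebra.Build ringR BMW (@algquot_scaleAl _ _ bmw_rel).
HB.instance Definition _ :=
  GRing.Lalgebra_isAlgebra.Build ringR BMW (@algquot_scaleAr _ _ bmw_rel).

Lemma bmw_of_is_zmod_morphism : zmod_morphism bmw_of.
Proof. exact: pi_zspanB. Qed.
Lemma bmw_of_is_monoid_morphism : monoid_morphism bmw_of.
Proof. by split; [exact: bmw_of1 | exact: bmw_ofM]. Qed.
HB.instance Definition _ :=
  GRing.isZmodMorphism.Build _ _ bmw_of bmw_of_is_zmod_morphism.
HB.instance Definition _ :=
  GRing.isMonoidMorphism.Build _ _ bmw_of bmw_of_is_monoid_morphism.

Definition bmw_elt (g : braid3) : BMW := bmw_of (grpelt ringR g).

Lemma bmw_eltM g k : bmw_elt (g * k)%g = bmw_elt g * bmw_elt k.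
Proof.
rewrite -bmw_ofM; congr bmw_of; symmetry.
by apply: etrans (grpalg_mulUU _ _ _ _) _; rewrite mulr1.
Qed.

Lemma bmw_genK i : bmw_gen i * bmw_genV i = 1.
Proof. by rewrite -[LHS]bmw_eltM mulgV. Qed.

Lemma bmw_genVK i : bmw_genV i * bmw_gen i = 1.
Proof. by rewrite -[LHS]bmw_eltM mulVg. Qed.

Lemma bmw_braid : bmw_gen ord0 * bmw_gen ord_max * bmw_gen ord0 =
  bmw_gen ord_max * bmw_gen ord0 * bmw_gen ord_max.
Proof.
have piM u v : (\pi_braid3 u * \pi_braid3 v)%g = \pi_braid3 (u ++ v) := pi_braid_mul u v.
rewrite -!bmw_eltM /sigma !piM; congr bmw_elt.
exact/eq_braidP/braid_artin.
Qed.

Lemma bmw_of_rel x : bmw_rel x -> bmw_of x = 0.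
Proof.
move=> Xx; rewrite -(raddf0 bmw_of); apply/eq_quotP; rewrite subr0.
by rewrite -[x]mulr1 -[x]mul1r; apply/zspan_gen/IdealGen.
Qed.

Lemma bmw_ofZ c x : bmw_of (c *: x) = c *: bmw_of x.
Proof. exact: esym (algquot_piZ bmw_rel c x). Qed.

Lemma bmw_cubic i : (bmw_gen i - aR%:A) * (bmw_gen i - bR%:A) * (bmw_gen i - cR%:A) = 0.
Proof.
apply: etrans (esym (image_cubic (h := idfun) bmw_ofZ _ aR bR cR)) _.
exact/bmw_of_rel/BmwCubic.
Qed.

Lemma bmw_skein (s1 := bmw_gen ord0) (s2 := bmw_gen ord_max)
    (t1 := bmw_genV ord0) (t2 := bmw_genV ord_max) :
  - yR *: (s1 * t2 * s1) + yR ^+ 2 *: (t2 * s1 * t2) - s1 * s2 * s1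
  - (xR * yR ^+ 2) *: (t2 * t2) + xR *: (s1 * s1) + yR ^+ 3 *: (t2 * t1 * t2) = 0.
Proof.
have := image_skein (h := idfun) bmw_ofZ xR yR.
have := bmw_of_rel BmwSkein; rewrite -expVgn expgS expg1 expgS expg1 => E F.
by rewrite -!bmw_eltM; apply: etrans (esym (F _ _ _ _ _ _)) E.
Qed.

(** Every braid is a word in the four letters and braids span [BMW], so spanning reduces to
    stability under left multiplication by letters. *)
Lemma bmw_ind (Q : BMW -> Prop) :
  (forall c x y, Q x -> Q y -> Q (c *: x + y)) -> Q 1 ->
  (forall i x, Q x -> Q (bmw_gen i * x)) -> (forall i x, Q x -> Q (bmw_genV i * x)) ->
  forall x, Q x.
Proof.
move=> QD Q1 QS QT x.
have Q0 : Q 0 by have := QD (-1) 1 1 Q1 Q1; rewrite scaleN1r addNr.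
have Qelt g : Q (bmw_elt g).
  rewrite -[g]reprK; elim: (repr g) => [//|[i e] u IHu].
  have -> : \pi_braid3 ((i, e) :: u) = (\pi_braid3 [:: (i, e)] * \pi_braid3 u)%g.
    by rewrite [RHS]pi_braid_mul.
  rewrite bmw_eltM; case: e; first exact: QS.
  have -> : \pi_braid3 [:: (i, false)] = (sigma i)^-1%g.
    apply: (mulgI (sigma i)); rewrite mulgV [LHS]pi_braid_mul.
    exact/eq_braidP/(braid_cancel i true).
  exact: QT.
rewrite -[x]reprK; elim/grpalg_ind: (repr x) => [||c g].
- by have := raddf0 bmw_of; rewrite /bmw_of => ->.
- move=> u v Qu Qv; have := QD 1 _ _ Qu Qv; rewrite scale1r.
  by have := raddfD bmw_of u v; rewrite /bmw_of => ->.
have := QD c _ _ (Qelt g) Q0; rewrite addr0 -bmw_ofZ; congr (Q (bmw_of _)).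
by rewrite grpalg_scaleU mulr1.
Qed.

(** * Eigenvector elements of a cubic generator *)

(** The residues 0, 1, -1 modulo 3 will index the parameters a, b, c. *)
Lemma I3_ind (Q : 'I_3 -> Prop) : Q 0 -> Q 1 -> Q (-1) -> forall i, Q i.
Proof.
move=> Q0 Q1 Q2 [[|[|[|//]]] lti].
- by have -> : Ordinal lti = 0 by apply/val_inj.
- by have -> : Ordinal lti = 1 by apply/val_inj.
- by have -> : Ordinal lti = -1 by apply/val_inj.
Qed.

Lemma I3_11 : 1 + 1 = -1 :> 'I_3. Proof. exact/val_inj. Qed.
Lemma I3_N1N1 : -1 - 1 = 1 :> 'I_3. Proof. exact/val_inj. Qed.
Definition I3E := (I3_11, I3_N1N1, addNr (1 : 'I_3), subrr (1 : 'I_3),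
  add0r (1 : 'I_3), sub0r (1 : 'I_3)).

Lemma sum_I3 (V : zmodType) (F : 'I_3 -> V) : \sum_i F i = F 0 + F 1 + F (-1).
Proof.
rewrite !big_ord_recl big_ord0 addr0 addrA; congr (F _ + F _ + F _); exact/val_inj.
Qed.

Lemma I3_neq : ((0 == 1 :> 'I_3) = false) * ((1 == 0 :> 'I_3) = false)
  * ((0 == -1 :> 'I_3) = false) * ((-1 == 0 :> 'I_3) = false)
  * ((1 == -1 :> 'I_3) = false) * ((-1 == 1 :> 'I_3) = false).
Proof. by []. Qed.

Definition I3S := (I3E, I3_neq, addr0 (1 : 'I_3), addr0 (-1 : 'I_3), addr0 (0 : 'I_3),
  opprK (1 : 'I_3), add0r (-1 : 'I_3), oppr0 'I_3,
  eqxx (0 : 'I_3), eqxx (1 : 'I_3), eqxx (-1 : 'I_3)).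

Lemma I2_ind (Q : 'I_2 -> Prop) : Q 0 -> Q 1 -> forall i, Q i.
Proof.
move=> Q0 Q1 [[|[|//]] lti].
- by have -> : Ordinal lti = 0 by apply/val_inj.
- by have -> : Ordinal lti = 1 by apply/val_inj.
Qed.

Lemma sum_I2 (V : zmodType) (F : 'I_2 -> V) : \sum_i F i = F 0 + F 1.
Proof. by rewrite !big_ord_recl big_ord0 addr0; congr (F _ + F _); exact/val_inj. Qed.

Lemma lift_I3_0 : lift ord0 (0 : 'I_2) = 1 :> 'I_3. Proof. exact/val_inj. Qed.
Lemma lift_I3_1 : lift ord0 (1 : 'I_2) = -1 :> 'I_3. Proof. exact/val_inj. Qed.
Lemma I2_neq : ((0 == 1 :> 'I_2) = false) * ((1 == 0 :> 'I_2) = false) * (1 + 1 = 0 :> 'I_2).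
Proof. by do !split; apply/val_inj. Qed.

Definition I2S := (I2_neq, lift_I3_0, lift_I3_1,
  eqxx (0 : 'I_2), eqxx (1 : 'I_2), add0r (1 : 'I_2)).

Lemma I2_cases (i : 'I_2) : i = ord0 \/ i = ord_max.
Proof. by case: i => -[|[|//]] lti; [left | right]; apply/val_inj. Qed.

Fact eig_key : unit. Proof. exact: tt. Qed.

(* Indices live in Z/3, so that i + 1 and i - 1 are the two other ones. *)
Section Eigenprojections.
Variables (R : comNzRingType) (A : algType R) (l : 'I_3 -> R).

(* Locked, so that rewriting with associativity does not see through it. *)
Definition eig (s : A) i :=
  locked_with eig_key ((s - (l (i + 1))%:A) * (s - (l (i - 1))%:A)).

Lemma eig_unlock s i : eig s i = (s - (l (i + 1))%:A) * (s - (l (i - 1))%:A).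
Proof. by rewrite /eig unlock. Qed.

Local Notation sigma1 := (l 0 + l 1 + l (-1)).
Local Notation sigma2 := (l 0 * l 1 + l 1 * l (-1) + l (-1) * l 0).
Local Notation sigma3 := (l 0 * l 1 * l (-1)).

(** As polynomials in s, these elements lie in the image of R[X], where identities between them
    become commutative ring identities. *)
Lemma eigE s i : eig s i = horner_alg s (('X - (l (i + 1))%:P) * ('X - (l (i - 1))%:P)).
Proof. by rewrite eig_unlock rmorphM !rmorphB /= horner_algX !horner_algC. Qed.

Lemma eig_expand s i :
  eig s i = s * s - (l (i + 1) + l (i - 1)) *: s + (l (i + 1) * l (i - 1)) *: 1.
Proof.
rewrite eigE; set p := _ * _.
have -> : p = 'X * 'X - (l (i + 1) + l (i - 1))%:P * 'X + (l (i + 1) * l (i - 1))%:P.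
  by rewrite /p polyCD polyCM; ring.
rewrite rmorphD rmorphB !rmorphM /= horner_algX !horner_algC mulr_algl.
by rewrite mulr_algl scalerA.
Qed.

(** Lagrange interpolation of the constant 1 at the three parameters, multiplied by the product of
    their cyclic differences to clear denominators. *)
Lemma eig_sum s : (\prod_i (l i - l (i + 1))) *: 1 = \sum_i (l (i - 1) - l (i + 1)) *: eig s i.
Proof.
set D := \prod_i _.
have -> : D *: 1 = horner_alg s D%:P by rewrite horner_algC.
have hornerZ c p : c *: horner_alg s p = horner_alg s (c%:P * p).
  by rewrite rmorphM /= horner_algC mulr_algl.
under eq_bigr => i _ do rewrite eigE hornerZ.
rewrite -raddf_sum /=; congr (horner_alg s _).
rewrite {}/D sum_I3 !big_ord_recl big_ord0 mulr1.
have -> : lift ord0 (lift ord0 ord0) = -1 :> 'I_3 by apply/val_inj.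
have -> : lift ord0 ord0 = 1 :> 'I_3 by apply/val_inj.
by rewrite !I3E !(polyCM, polyCB); ring.
Qed.

Section Cubic.
Variables (s t : A).
Hypotheses (st : s * t = 1) (ts : t * s = 1).
Hypothesis cubic : (s - (l 0)%:A) * (s - (l 1)%:A) * (s - (l (-1))%:A) = 0.

Lemma mul_eig i : s * eig s i = l i *: eig s i.
Proof.
apply/eqP; rewrite -subr_eq0 -mulr_algl -mulrBl; apply/eqP.
rewrite -[RHS]cubic.
have charE u v w : horner_alg s (('X - u%:P) * (('X - v%:P) * ('X - w%:P))) =
    (s - u%:A) * ((s - v%:A) * (s - w%:A)).
  by rewrite !rmorphM !rmorphB /= horner_algX !horner_algC.
rewrite eig_unlock -mulrA -!charE; congr (horner_alg s _).
by elim/I3_ind: i; rewrite !I3E; ring.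
Qed.

Lemma eig_mul i : eig s i * s = l i *: eig s i.
Proof.
rewrite -mul_eig; rewrite eigE -{2 3}[s]horner_algX -!rmorphM.
by congr (horner_alg s _); ring.
Qed.

(** This is the cubic relation divided by s, written with the elementary symmetric functions of the
    parameters. *)
Lemma inv_expand : sigma3 *: t = s * s - sigma1 *: s + sigma2 *: 1.
Proof.
set q := RHS.
suff sq : s * q = sigma3%:A by rewrite -mulr_algr -sq mulrA ts mul1r.
have -> : q = horner_alg s ('X * 'X - sigma1%:P * 'X + sigma2%:P).
  by rewrite rmorphD rmorphB !rmorphM /= horner_algX !horner_algC mulr_algl.
have cubicE : horner_alg s (('X - (l 0)%:P) * ('X - (l 1)%:P) * ('X - (l (-1))%:P)) = 0.
  by rewrite !rmorphM !rmorphB /= horner_algX !horner_algC.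
transitivity (horner_alg s ('X * ('X * 'X - sigma1%:P * 'X + sigma2%:P))).
  by rewrite [RHS]rmorphM /= horner_algX.
rewrite -[RHS](horner_algC s) -[RHS]add0r -cubicE -rmorphD; congr (horner_alg s _).
by rewrite !(polyCD, polyCM); ring.
Qed.

End Cubic.
End Eigenprojections.

(** * Spanning *)

Section SkeinAlgebra.
Variables (R : comNzRingType) (A : algType R) (l : 'I_3 -> R).
Variables (s1 t1 s2 t2 : A).
Hypotheses (s1t1 : s1 * t1 = 1) (t1s1 : t1 * s1 = 1).
Hypotheses (s2t2 : s2 * t2 = 1) (t2s2 : t2 * s2 = 1).
Hypothesis braid : s1 * s2 * s1 = s2 * s1 * s2.
Hypothesis cubic1 : (s1 - (l 0)%:A) * (s1 - (l 1)%:A) * (s1 - (l (-1))%:A) = 0.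
Local Notation x := (l 1 + l (-1)).
Local Notation y := (l 1 * l (-1)).
Lemma conj_inv (w s s' t t' : A) : s' * t' = 1 -> t * s = 1 -> w * s' = s * w -> w * t' = t * w.
Proof. by move=> st ts e; rewrite -[LHS]mul1r -ts -mulrA (mulrA s) -e -mulrA st mulr1. Qed.

(** Conjugation by s2 s1 carries s2 to s1, and conjugation by s1 s2 carries s1 to s2; the next
    lemmas record both facts, also for the inverses. *)
Lemma s1_s2s1 : s2 * s1 * s2 = s1 * (s2 * s1). Proof. by rewrite mulrA braid. Qed.
Lemma t1_s2s1 : s2 * s1 * t2 = t1 * (s2 * s1). Proof. exact: conj_inv s2t2 t1s1 s1_s2s1. Qed.
Lemma s2_s1s2 : s1 * s2 * s1 = s2 * (s1 * s2). Proof. by rewrite mulrA braid. Qed.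
Lemma t2_s1s2 : s1 * s2 * t1 = t2 * (s1 * s2). Proof. exact: conj_inv s1t1 t2s2 s2_s1s2. Qed.

Lemma t2t1s2 : t2 * t1 * s2 = s1 * t2 * t1.
Proof.
have e : s2 * s1 * t2 * t1 = t1 * s2 by rewrite t1_s2s1 -!mulrA s1t1 mulr1.
by rewrite -mulrA -e !mulrA t2s2 mul1r.
Qed.

Lemma t2t1t2 : t2 * t1 * t2 = t1 * t2 * t1.
Proof.
have e : t2 * t1 * t2 * (s2 * s1 * s2) = 1.
  by rewrite -!mulrA (mulrA t2 s2) t2s2 mul1r (mulrA t1 s1) t1s1 mul1r t2s2.
have e' : s2 * s1 * s2 * (t1 * t2 * t1) = 1.
  by rewrite -braid -!mulrA (mulrA s1 t1) s1t1 mul1r (mulrA s2 t2) s2t2 mul1r s1t1.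
by rewrite -[LHS]mulr1 -e' mulrA e mul1r.
Qed.

(** Equals (s1 - b)(s1 - c) s1^-1, hence vanishes wherever s1 acts by b or c. *)
Let u1 := s1 - x *: 1 + y *: t1.
Let u2 := s2 - x *: 1 + y *: t2.

Lemma u1_s2s1 : u1 * (s2 * s1) = s2 * s1 * u2.
Proof.
rewrite /u1 /u2 !(mulrDr, mulrDl, mulrN, mulNr) -!(scalerAl, scalerAr) mulr1 mul1r.
by rewrite s1_s2s1 t1_s2s1.
Qed.

Lemma u2_s1s2 : u2 * (s1 * s2) = s1 * s2 * u1.
Proof.
rewrite /u1 /u2 !(mulrDr, mulrDl, mulrN, mulNr) -!(scalerAl, scalerAr) mulr1 mul1r.
by rewrite s2_s1s2 t2_s1s2.
Qed.

(** The generators are conjugate through s2 s1. For matrices the cubic relation thus has to be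
    checked only on the diagonal generator. *)
Lemma conj_cubic2 : (s2 - (l 0)%:A) * (s2 - (l 1)%:A) * (s2 - (l (-1))%:A) = 0.
Proof.
have sh z u : z * (s2 * s1) * (s2 - u%:A) = z * (s1 - u%:A) * (s2 * s1).
  by rewrite -!(mulrA z) mulrBr mulrBl s1_s2s1 mulr_algr mulr_algl.
have w1 : t1 * t2 * (s2 * s1) = 1 by rewrite -!mulrA (mulrA t2) t2s2 mul1r.
set P := LHS; have -> : P = t1 * t2 * (s2 * s1 * P) by rewrite mulrA w1 mul1r.
suff -> : s2 * s1 * P = 0 by rewrite mulr0.
by rewrite -[s2 * s1]mul1r /P !(mulrA (1 * _)) !sh mul1r cubic1 mul0r.
Qed.

(** Each of the two products expands into three of the six skein terms; the two terms with x come
    from the constant parts of [u1] and [u2]. *)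
Lemma skein_diff : y ^+ 2 *: (t2 * u1 * t2) - s1 * u2 * s1 =
  - y *: (s1 * t2 * s1) + y ^+ 2 *: (t2 * s1 * t2) - s1 * s2 * s1
  - (x * y ^+ 2) *: (t2 * t2) + x *: (s1 * s1) + y ^+ 3 *: (t2 * t1 * t2).
Proof.
rewrite /u1 /u2; move: (l 1 + l (-1)) => v.
rewrite !(mulrDr, mulrDl, mulrN, mulNr) -!(scalerAl, scalerAr) !mulr1.
rewrite scalerDr scalerBr !scalerA -exprSr (mulrC _ v) scaleNr.
move: (y *: _) (y ^+ 2 *: _) (s1 * s2 * s1) (_ *: (t2 * t2)) (_ *: (s1 * s1)) (y ^+ 3 *: _).
move=> a b c d e f.
by rewrite !opprD opprK !addrA [LHS](ACl (6*1*4*2*5*3)).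
Qed.

(** Multiplying the hypothesis by s2^-1 on the left and moving [u1] across s2 s1 gives the balanced
    form of the skein relation. For diagonal s1 the hypothesis is an entrywise condition on s2 and
    its inverse. *)
Lemma skein_of_eig0 : u1 * s2 * s1 * s1 = y ^+ 2 *: (u1 * t2) ->
  - y *: (s1 * t2 * s1) + y ^+ 2 *: (t2 * s1 * t2) - s1 * s2 * s1
  - (x * y ^+ 2) *: (t2 * t2) + x *: (s1 * s1) + y ^+ 3 *: (t2 * t1 * t2) = 0.
Proof.
move=> e; rewrite -skein_diff -(mulrA t2) scalerAr -e -(mulrA u1) u1_s2s1.
by rewrite !mulrA t2s2 mul1r subrr.
Qed.

Hypothesis cubic2 : (s2 - (l 0)%:A) * (s2 - (l 1)%:A) * (s2 - (l (-1))%:A) = 0.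
Hypothesis skein :
  - y *: (s1 * t2 * s1) + y ^+ 2 *: (t2 * s1 * t2) - s1 * s2 * s1
  - (x * y ^+ 2) *: (t2 * t2) + x *: (s1 * s1) + y ^+ 3 *: (t2 * t1 * t2) = 0.

Lemma skein_balanced : y ^+ 2 *: (t2 * u1 * t2) = s1 * u2 * s1.
Proof. by apply/eqP; rewrite -subr_eq0 skein_diff skein. Qed.

Lemma eig0E : eig l s1 0 = s1 * u1.
Proof.
rewrite eig_expand !I3E /u1 mulrDr mulrBr -!scalerAr mulr1 s1t1; congr (_ - _ *: _ + _).
Qed.
Lemma eig0Er : eig l s1 0 = u1 * s1.
Proof. by rewrite eig_expand !I3E /u1 mulrDl mulrBl -!scalerAl mul1r t1s1. Qed.

Lemma eig0_t2 : y ^+ 2 *: (eig l s1 0 * t2) = eig l s1 0 * s2 * s1 * s1.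
Proof.
have e : y ^+ 2 *: (u1 * t2) = u1 * s2 * s1 * s1.
  rewrite -(mulrA u1) u1_s2s1 -!mulrA (mulrA s1) -skein_balanced -scalerAr.
  by rewrite !mulrA s2t2 mul1r.
by rewrite eig0E -!mulrA scalerAr e !mulrA.
Qed.

Lemma t2_eig0 : y ^+ 2 *: (t2 * eig l s1 0) = s1 * s1 * s2 * eig l s1 0.
Proof.
have e : y ^+ 2 *: (t2 * u1) = s1 * s1 * s2 * u1.
  rewrite -(mulrA s1 s1) -(mulrA s1) -u2_s1s2 !mulrA -skein_balanced -scalerAl.
  by rewrite -!mulrA t2s2 mulr1.
by rewrite eig0Er !mulrA -e -scalerAl.
Qed.

(* [sat] collects the scalars by which membership may be divided. *)
Section Saturated.
Variables (sat : R -> Prop) (mem : A -> Prop).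
Hypothesis mem_lin : forall c m n, mem m -> mem n -> mem (c *: m + n).
Hypothesis satM : forall c d, sat c -> sat d -> sat (c * d).
Hypothesis mem_sat : forall c m, sat c -> mem (c *: m) -> mem m.
Hypothesis sat_l : forall i, sat (l i).
Hypothesis sat_lB : forall i, sat (l i - l (i + 1)).
Local Notation e := (eig l s1).
Hypothesis mem_e : forall i, mem (e i).
Hypothesis mem_s : forall i j, mem (e i * s2 * e j).
Hypothesis mem_t : forall i j : 'I_2, mem (e (lift 0 i) * t2 * e (lift 0 j)).
(** Expresses that the sixteen elements span [mem]: stability under left multiplication is tested on
    them alone. *)
Hypothesis mem_mul : forall g, (forall i, mem (g * e i)) ->
  (forall i j, mem (g * (e i * s2 * e j))) ->
  (forall i j : 'I_2, mem (g * (e (lift 0 i) * t2 * e (lift 0 j)))) ->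
  forall m, mem m -> mem (g * m).

Lemma mem0 : mem 0.
Proof. by have := mem_lin (-1) (mem_e 0) (mem_e 0); rewrite scaleN1r addNr. Qed.
Lemma memD m n : mem m -> mem n -> mem (m + n).
Proof. by move=> mm mn; have := mem_lin 1 mm mn; rewrite scale1r. Qed.
Lemma memZ c m : mem m -> mem (c *: m).
Proof. by move=> mm; have := mem_lin c mm mem0; rewrite addr0. Qed.
Lemma memN m : mem m -> mem (- m).
Proof. by rewrite -scaleN1r; apply: memZ. Qed.
Lemma memB m n : mem m -> mem n -> mem (m - n).
Proof. by move=> mm mn; apply/memD/memN. Qed.
Lemma mem_sum I r (P : pred I) F : (forall i, P i -> mem (F i)) -> mem (\sum_(i <- r | P i) F i).
Proof. by apply: big_ind => //; [exact: mem0 | exact: memD]. Qed.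

Lemma sat_y : sat (y ^+ 2).
Proof. by rewrite expr2; apply/satM/satM => //; apply: satM. Qed.

Lemma s1_e i : s1 * e i = l i *: e i. Proof. exact: mul_eig cubic1 i. Qed.
Lemma e_s1 i : e i * s1 = l i *: e i. Proof. exact: eig_mul cubic1 i. Qed.

(** By [eig0_t2] and [t2_eig0], y^2 times such an element is the corresponding product with s2 times
    the square of an eigenvalue. *)
Lemma mem_t0 i j : i = 0 \/ j = 0 -> mem (e i * t2 * e j).
Proof.
case=> ->; apply: (mem_sat sat_y).
  rewrite scalerAl eig0_t2 -!mulrA s1_e -!scalerAr s1_e -!scalerAr mulrA.
  exact/memZ/memZ/mem_s.
rewrite -mulrA scalerAr t2_eig0 !mulrA e_s1 -!scalerAl e_s1 -!scalerAl.
exact/memZ/memZ/mem_s.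
Qed.

Lemma mem_tt i j : mem (e i * t2 * e j).
Proof.
case: (unliftP 0 i) => [i' ->|->]; last by apply: mem_t0; left.
case: (unliftP 0 j) => [j' ->|->]; last by apply: mem_t0; right.
exact: mem_t.
Qed.

(** Stands for membership in the span of the e_i up to denominators; it covers the polynomials in s1
    and s1^-1 that occur around s2 and s2^-1. *)
Definition semidiag p := exists d c, sat d /\ d *: p = \sum_i c i *: e i.

Lemma sat_prod : sat (\prod_i (l i - l (i + 1))).
Proof. by rewrite !big_ord_recl big_ord0 mulr1; do 2![apply: (satM) => //]. Qed.

Lemma semidiag1 : semidiag 1.
Proof.
exists (\prod_i (l i - l (i + 1))), (fun i => l (i - 1) - l (i + 1)).
by split; [exact: sat_prod | exact: eig_sum].
Qed.

Lemma semidiag_s p : semidiag p -> semidiag (s1 * p).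
Proof.
move=> [d [c [sd E]]]; exists d, (fun i => c i * l i); split=> //.
rewrite scalerAr E mulr_sumr; apply: eq_bigr => i _.
by rewrite -scalerAr s1_e scalerA.
Qed.

Lemma semidiag_t p : semidiag p -> semidiag (t1 * p).
Proof.
move=> [d [c [sd E]]]; exists (l 0 * l 1 * l (-1) * d), (fun i => c i * (l (i + 1) * l (i - 1))).
split; first by do 3![apply: (satM) => //].
rewrite -scalerA scalerAr E mulr_sumr scaler_sumr; apply: eq_bigr => i _.
have {2}<- : l i *: (t1 * e i) = e i by rewrite scalerAr -s1_e mulrA t1s1 mul1r.
rewrite -scalerAr !scalerA; congr (_ *: _).
by elim/I3_ind: i; rewrite !I3E; ring.
Qed.

Lemma semidiag_e i : semidiag (e i).
Proof.
(* The denominator must be known to satisfy [sat], which is not assumed of 1; the product of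
   differences is available. *)
exists (\prod_i (l i - l (i + 1))), (fun j => if j == i then \prod_i (l i - l (i + 1)) else 0).
split; first exact: sat_prod.
rewrite [RHS](bigD1 i) //= eqxx [X in _ + X]big1 ?addr0 // => j /negPf ->; exact: scale0r.
Qed.

Lemma mem_semidiag p : semidiag p -> mem p.
Proof.
move=> [d [c [sd E]]]; apply: (mem_sat sd); rewrite E.
by apply: mem_sum => i _; apply: memZ.
Qed.

Lemma mem_sandwich z p q : (forall i j, mem (e i * z * e j)) ->
  semidiag p -> semidiag q -> mem (p * z * q).
Proof.
move=> mz [d [c [sd E]]] [d' [c' [sd' E']]].
apply: (mem_sat (satM sd sd')); rewrite -scalerA.
have -> : d *: (d' *: (p * z * q)) = d *: p * z * (d' *: q).
  by rewrite -!scalerAl -!scalerAr.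
rewrite E E' mulr_suml mulr_suml; apply: mem_sum => i _.
rewrite mulr_sumr; apply: mem_sum => j _.
by rewrite -!scalerAl -scalerAr; apply/memZ/memZ.
Qed.

Lemma mem_ps p q : semidiag p -> semidiag q -> mem (p * s2 * q).
Proof. exact: mem_sandwich. Qed.

Lemma mem_pt p q : semidiag p -> semidiag q -> mem (p * t2 * q).
Proof. exact/mem_sandwich/mem_tt. Qed.

Lemma mem_s1 m : mem m -> mem (s1 * m).
Proof.
apply: mem_mul => [i|i j|i j]; rewrite ?mulrA s1_e -?scalerAl; apply: memZ => //.
Qed.

Local Notation sigma1 := (l 0 + l 1 + l (-1)).
Local Notation sigma2 := (l 0 * l 1 + l 1 * l (-1) + l (-1) * l 0).
Local Notation sigma3 := (l 0 * l 1 * l (-1)).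

Lemma sat_sigma3 : sat sigma3. Proof. by do 2![apply: (satM) => //]. Qed.

(** Eliminating s1^2 by the cubic relation leaves s1^-1, s1 and 1. With e_i in this form between
    s2^-1 and s2 or s2^-1, the braid relations become applicable. *)
Lemma e_via_t1 i : e i = sigma3 *: t1 + (l i *: s1 - (sigma2 - l (i + 1) * l (i - 1)) *: 1).
Proof.
rewrite (inv_expand t1s1 cubic1) eig_expand.
have -> : sigma1 = l i + (l (i + 1) + l (i - 1)).
  by elim/I3_ind: i; rewrite !I3E; ring.
move: (l (i + 1) + l (i - 1)) sigma2 => u v; rewrite scalerBl scalerDl !opprD opprK.
by rewrite !addrA [RHS](ACl (1*3*7*(2*5)*(4*6))) /= addNr subrr !addr0.
Qed.

Lemma t2t2 : sigma3 *: (t2 * t2) = s2 - sigma1 *: 1 + sigma2 *: t2.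
Proof.
rewrite scalerAl (inv_expand t2s2 cubic2) mulrDl mulrBl -mulrA s2t2 mulr1.
by rewrite -!scalerAl s2t2 mul1r.
Qed.

Lemma mem_t2_e (F : A -> A) :
  (forall c p q, F (c *: p + q) = c *: F p + F q) ->
  mem (F 1) -> mem (F s1) -> mem (F t1) -> forall i, mem (F (e i)).
Proof.
move=> FL m1 ms mt i; rewrite e_via_t1 -scaleNr !FL.
have F0 : F 0 = 0 by have := FL (-1) 0 0; rewrite !scaleN1r !addNr.
by rewrite -[_ *: 1]addr0 FL F0; do ![apply: mem_lin] => //; apply: mem0.
Qed.

Lemma mem_t2t2 q : semidiag q -> mem (t2 * t2 * q).
Proof.
move=> sq; apply: (mem_sat sat_sigma3); rewrite scalerAl t2t2 mulrDl mulrBl -!scalerAl mul1r.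
have := mem_ps semidiag1 sq; have := mem_pt semidiag1 sq; rewrite !mul1r => mt ms.
by apply: memD; [apply: memB => //; apply/memZ/mem_semidiag | apply: memZ].
Qed.

(** The skein relation is solved for y^2 s2^-1 s1 s2^-1. After replacing s2^-1 s1^-1 s2^-1 by s1^-1
    s2^-1 s1^-1, only the term in s2^-2 keeps two factors of index 2, and [mem_t2t2] handles it. *)
Lemma mem_t2s1t2 q : semidiag q -> mem (t2 * s1 * t2 * q).
Proof.
move=> sq; apply: (mem_sat sat_y).
have ss := semidiag_s semidiag1; have st := semidiag_t semidiag1; rewrite !mulr1 in ss st.
have E : y ^+ 2 *: (t2 * s1 * t2) = y *: (s1 * t2 * s1) + s1 * s2 * s1
    + (x * y ^+ 2) *: (t2 * t2) - x *: (s1 * s1) - y ^+ 3 *: (t1 * t2 * t1).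
  apply/eqP; rewrite -subr_eq0 -[eqbRHS]skein scaleNr t2t1t2; apply/eqP.
  move: (y *: _) (y ^+ 2 *: _) (s1 * s2 * s1) (_ *: (t2 * t2)) (_ *: (s1 * s1)) (y ^+ 3 *: _).
  move=> a b c d f g.
  by rewrite !opprD !opprK !addrA [LHS](ACl (2*1*3*4*5*6)).
rewrite scalerAl E !mulrDl !mulNr -!scalerAl -!(mulrA _ s1) -!(mulrA _ t1).
do ![apply: memD | apply: memN | apply: memZ].
- exact: mem_pt ss (semidiag_s sq).
- exact: mem_ps ss (semidiag_s sq).
- exact: mem_t2t2.
- exact: mem_semidiag (semidiag_s (semidiag_s sq)).
- exact: mem_pt st (semidiag_t sq).
Qed.

(** The inner e_i is replaced by 1, s1 and s1^-1. Before s2 the braid relations leave at most one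
    letter of index 2; before s2^-1 the three cases are the cubic relation, the skein relation and
    the braid relation. *)
Lemma mem_t2 m : mem m -> mem (t2 * m).
Proof.
have ss := semidiag_s semidiag1; have st := semidiag_t semidiag1; rewrite !mulr1 in ss st.
apply: mem_mul => [i|i j|i j]; first by rewrite -[t2]mul1r; apply: mem_pt semidiag1 (semidiag_e i).
  have se := semidiag_e j.
  rewrite !mulrA; move: i; apply: (mem_t2_e (F := fun p => t2 * p * s2 * e j)) => [c p q|||].
  - by rewrite mulrDr !mulrDl -scalerAr -!scalerAl.
  - by rewrite mulr1 t2s2 mul1r; apply: mem_semidiag.
  - have -> : t2 * s1 * s2 = s1 * s2 * t1 by rewrite t2_s1s2 mulrA.
    by rewrite -mulrA; apply: mem_ps (semidiag_t se).
  - by rewrite t2t1s2 -mulrA; apply: mem_pt (semidiag_t se).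
have := semidiag_e (lift 0 j); move: (e _) => q sq; rewrite !mulrA.
move: (lift 0 i); apply: (mem_t2_e (F := fun p => t2 * p * t2 * q)) => [c p r|||].
- by rewrite mulrDr !mulrDl -scalerAr -!scalerAl.
- by rewrite mulr1; apply: mem_t2t2.
- exact: mem_t2s1t2.
- by rewrite t2t1t2 -mulrA; apply: mem_pt (semidiag_t sq).
Qed.

Lemma mem_t1 m : mem m -> mem (t1 * m).
Proof.
move=> mm; apply: (mem_sat sat_sigma3); rewrite scalerAl (inv_expand t1s1 cubic1).
rewrite mulrDl mulrBl -mulrA -!scalerAl mul1r; apply/memD; last exact: memZ.
by apply: memB; [do 2!apply: mem_s1 | apply/memZ/mem_s1].
Qed.

Lemma mem_s2 m : mem m -> mem (s2 * m).
Proof.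
move=> mm.
have -> : s2 * m = sigma3 *: (t2 * (t2 * m)) + sigma1 *: m - sigma2 *: (t2 * m).
  rewrite [t2 * (t2 * m)]mulrA scalerAl t2t2 mulrDl mulrBl -!scalerAl mul1r.
  by rewrite addrAC addrK subrK.
by apply: memB; [apply: memD; apply: memZ => //; do 2!apply: mem_t2 | apply/memZ/mem_t2].
Qed.

Lemma mem_1 : mem 1. Proof. exact: mem_semidiag semidiag1. Qed.

Lemma skein_algebra_mem : [/\ mem 1, forall m, mem m -> mem (s1 * m),
  forall m, mem m -> mem (s2 * m), forall m, mem m -> mem (t1 * m)
  & forall m, mem m -> mem (t2 * m)].
Proof. split; [exact: mem_1|exact: mem_s1|exact: mem_s2|exact: mem_t1|exact: mem_t2]. Qed.

End Saturated.
End SkeinAlgebra.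

(** * Representations with diagonal s1 *)

Definition eigR (i : 'I_3) : ringR := nth 0 [:: aR; bR; cR] i.

Section DiagonalRepresentation.
Variables (K : fieldType) (h : {rmorphism ringR -> K}).
Local Notation l := (fun i => h (eigR i)).
Local Notation x := (l 1 + l (-1)).
Local Notation y := (l 1 * l (-1)).
Hypothesis l_neq0 : forall i, l i != 0.

Variables (n : nat) (nu : 'I_n.+1 -> 'I_3) (S T : 'M[K]_n.+1).
Hypothesis ST : forall p q, \sum_k S p k * T k q = (p == q)%:R.
Hypothesis braidS : forall p q,
  l (nu p) * S p q * l (nu q) = \sum_k S p k * l (nu k) * S k q.
Hypothesis skeinS : forall p q, let mu := l (nu p) - x + y / l (nu p) in
  mu * S p q * l (nu q) ^+ 2 = y ^+ 2 * (mu * T p q).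

Definition diag_gen (i : 'I_2) : 'M[K]_n.+1 :=
  if i == ord0 then diag_mx (\row_p l (nu p)) else S.
Definition diag_genV (i : 'I_2) : 'M[K]_n.+1 :=
  if i == ord0 then diag_mx (\row_p (l (nu p))^-1) else T.

Lemma scalar_diag c : c%:A = diag_mx (\row_p c) :> 'M[K]_n.+1.
Proof. by apply/matrixP=> i j; rewrite !mxE mulr_natr. Qed.

(** With s1 diagonal, [u1] is diagonal with entries mu, so the skein condition becomes [skeinS]
    through [skein_of_eig0], and the cubic relation for S follows by conjugation. *)
Lemma diag_representation : exists phi, bmw_representation h diag_gen diag_genV phi.
Proof.
have ST1 : S * T = 1.
  by apply/matrixP=> p q; rewrite !mxE -ST; apply: eq_bigr.
have D1 : diag_mx (\row_p l (nu p)) * diag_mx (\row_p (l (nu p))^-1) = 1 :> 'M_n.+1.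
  rewrite -mulmxE mulmx_diag -[1%R]/(1%:M) -diag_const_mx; congr diag_mx.
  by apply/rowP=> p; rewrite !mxE mulfV.
have C1 (A B : 'M[K]_n.+1) : A * B = 1 -> B * A = 1 := @mulmx1C _ _ A B.
have xE : h xR = x by rewrite -rmorphD.
have yE : h yR = y by rewrite -rmorphM.
have braid : diag_gen ord0 * S * diag_gen ord0 = S * diag_gen ord0 * S.
  apply/matrixP=> p q; rewrite -!mulmxE mul_mx_diag mul_diag_mx [RHS]mxE !mxE braidS.
  by apply: eq_bigr => k _; rewrite mul_mx_diag !mxE.
have cubic1 : (diag_gen ord0 - (l 0)%:A) * (diag_gen ord0 - (l 1)%:A)
    * (diag_gen ord0 - (l (-1))%:A) = 0.
  rewrite !scalar_diag /diag_gen /= -!raddfB -!mulmxE /= !mulmx_diag.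
  rewrite -[RHS](raddf0 (@diag_mx K n.+1)); congr diag_mx.
  by apply/rowP=> p; rewrite !mxE; elim/I3_ind: (nu p); rewrite subrr ?(mul0r, mulr0).
apply: bmw_lift.
- by move=> i; rewrite /diag_gen /diag_genV; case: ifP.
- by move=> i; rewrite /diag_gen /diag_genV; case: ifP => _; exact: C1.
- exact: braid.
- move=> i; rewrite /diag_gen; case: ifP => _; first exact: cubic1.
  exact: (@conj_cubic2 _ _ (fun i => h (eigR i)) _ _ _ _ (C1 _ _ D1) (C1 _ _ ST1) braid cubic1).
rewrite xE yE; apply: (@skein_of_eig0 _ _ (fun i => h (eigR i))) => //.
- exact: C1 D1.
- exact: C1 ST1.
rewrite [diag_gen ord_max]/diag_gen [diag_genV ord_max]/diag_genV /=.
rewrite /diag_gen /diag_genV /= scalar_diag -linearZ -raddfB -raddfD /=.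
apply/matrixP=> p q; rewrite -!mulmxE !mul_diag_mx !mul_mx_diag !mxE.
by rewrite -mulrA -expr2 skeinS.
Qed.
End DiagonalRepresentation.

(** * Explicit representations and the linear system behind independence *)

Section Representations.
Variables (K : fieldType) (l : 'I_3 -> K).
Hypothesis l_neq0 : forall i, l i != 0.
Hypothesis lB_neq0 : forall i, l i - l (i + 1) != 0.
Local Notation x := (l 1 + l (-1)).
Local Notation y := (l 1 * l (-1)).
Local Notation a := (l 0).
Local Notation b := (l 1).
Local Notation c := (l (-1)).

Let nz := (l_neq0 0, l_neq0 1, l_neq0 (-1)).
Let ab : a - b != 0. Proof. by have := lB_neq0 0; rewrite I3E. Qed.
Let bc : b - c != 0. Proof. by have := lB_neq0 1; rewrite I3E. Qed.
Let ca : c - a != 0. Proof. by have := lB_neq0 (-1); rewrite I3E. Qed.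
Let ba : b - a != 0. Proof. by rewrite -opprB oppr_eq0. Qed.
Let cb : c - b != 0. Proof. by rewrite -opprB oppr_eq0. Qed.
Let ac : a - c != 0. Proof. by rewrite -opprB oppr_eq0. Qed.
Let nzE := (nz, ab, bc, ca, ba, cb, ac).

(* With s1 diagonal, the braid relation determines the matrix of s2 up to conjugation by a
   diagonal matrix. For i <> j the third index is - (i + j) in Z/3. *)
Definition S3 : 'M[K]_3 := \matrix_(i, j)
  ((if i == j then l (i + 1) * l (i - 1) * (l (i + 1) + l (i - 1))
    else l (- (i + j)) * (l j ^+ 2 + l i * l (- (i + j))))
   / ((l i - l (i + 1)) * (l i - l (i - 1)))).
Definition T3 : 'M[K]_3 := \matrix_(i, j)
  (if i == j then S3 i j * (l i / (l (i + 1) * l (i - 1))) ^+ 2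
   else S3 i j / l (- (i + j)) ^+ 2).

Lemma S3T3 p q : \sum_k S3 p k * T3 k q = (p == q)%:R.
Proof.
rewrite sum_I3 !mxE; elim/I3_ind: p; elim/I3_ind: q; rewrite !I3S /=.
all: by field; rewrite ?nzE.
Qed.

Lemma S3_braid p q : l p * S3 p q * l q = \sum_k S3 p k * l k * S3 k q.
Proof.
rewrite sum_I3 !mxE; elim/I3_ind: p; elim/I3_ind: q; rewrite !I3S /=.
all: by field; rewrite ?nzE.
Qed.

(** Only row 0 has content, since mu vanishes at b and c; there the factor l_q^2 is matched by the
    ratio of y^2 to the scaling built into [T3]. *)
Lemma S3_skein p q : let mu := l p - x + y / l p in
  mu * S3 p q * l q ^+ 2 = y ^+ 2 * (mu * T3 p q).
Proof.
rewrite !mxE; elim/I3_ind: p; elim/I3_ind: q; rewrite !I3S /=.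
all: by field; rewrite ?nzE.
Qed.

Definition S2 : 'M[K]_2 := \matrix_(i, j)
  if i == 0 then if j == 0 then c ^+ 2 / (c - b) else b * c / (c - b)
  else if j == 0 then (b ^+ 2 - b * c + c ^+ 2) / (b - c) else b ^+ 2 / (b - c).
(** The matrix [S2] has trace b + c and determinant b c; this is its adjugate divided by the
    determinant, with i + 1 the other index modulo 2. *)
Definition T2 : 'M[K]_2 := \matrix_(i, j)
  ((if i == j then S2 (i + 1) (i + 1) else - S2 i j) / (b * c)).

Lemma S2T2 p q : \sum_k S2 p k * T2 k q = (p == q)%:R.
Proof.
rewrite sum_I2 !mxE; elim/I2_ind: p; elim/I2_ind: q; rewrite !I2S /=.
all: by field; rewrite ?nzE.
Qed.

Lemma S2_braid p q : l (lift ord0 p) * S2 p q * l (lift ord0 q)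
  = \sum_k S2 p k * l (lift ord0 k) * S2 k q.
Proof.
rewrite sum_I2 !mxE; elim/I2_ind: p; elim/I2_ind: q; rewrite !I2S /=.
all: by field; rewrite ?nzE.
Qed.

(** Both b and c are roots of v^2 - x v + y, which makes the skein condition automatic for these
    eigenvalues. *)
Lemma mu_lift p : l (lift ord0 p) - x + y / l (lift ord0 p) = 0.
Proof. by elim/I2_ind: p; rewrite !I2S; field; rewrite ?nzE. Qed.

Lemma S2_skein p q : let mu := l (lift ord0 p) - x + y / l (lift ord0 p) in
  mu * S2 p q * l (lift ord0 q) ^+ 2 = y ^+ 2 * (mu * T2 p q).
Proof. by rewrite /= mu_lift !mul0r mulr0. Qed.

Hypothesis dagger : a ^+ 2 = y.

Lemma scalar_skein i : let mu := l i - x + y / l i in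
  mu * l i * l i ^+ 2 = y ^+ 2 * (mu / l i).
Proof.
case: (unliftP ord0 i) => [j|] -> /=; first by rewrite mu_lift !mul0r mulr0.
rewrite [ord0](_ : _ = 0) // -dagger; field; rewrite ?nz //.
Qed.

(** The matrix entries and 2 by 2 determinants inverted below have numerators that factor, up to
    sign, into the parameters and these five polynomials. *)
Hypothesis nondeg_bc : b ^+ 2 - b * c + c ^+ 2 != 0.
Hypothesis nondeg_a : a ^+ 2 + b * c != 0.
Hypothesis nondeg_b : b ^+ 2 + a * c != 0.
Hypothesis nondeg_c : c ^+ 2 + a * b != 0.
Hypothesis nondeg : b + c - a != 0.

Definition gap i := (l i - l (i + 1)) * (l i - l (i - 1)).
Local Notation d := gap.

Lemma gap_neq0 i : d i != 0.
Proof. by elim/I3_ind: i; rewrite /gap !I3E mulf_neq0 ?nzE. Qed.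

(* [X], [Z] and [u] are the coefficients of e_i s2 e_j, e_i s2^-1 e_j and e_i. *)
Lemma coefficients_eq0 (X Z : 'M[K]_3) (u : 'I_3 -> K) :
  (forall i, Z 0 i = 0) -> (forall i, Z i 0 = 0) ->
  (forall i, d i * d i * (X i i * l i + Z i i / l i) + u i * d i = 0) ->
  (forall p q (i := lift ord0 p) (j := lift ord0 q),
    d i * d j * (X i j * S2 p q + Z i j * T2 p q) + (u i * d i) *+ (p == q) = 0) ->
  (forall i j, d i * d j * (X i j * S3 i j + Z i j * T3 i j) + (u i * d i) *+ (i == j) = 0) ->
  [/\ X = 0, Z = 0 & u =1 fun=> 0].
Proof.
move=> Z0r Z0l E1 E2 E3.
have offdiag i j : i != j -> X i j * S3 i j + Z i j * T3 i j = 0.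
  move=> /negPf ij; have /eqP := E3 i j; rewrite ij addr0 mulf_eq0.
  by rewrite (negPf (mulf_neq0 (gap_neq0 i) (gap_neq0 j))) => /eqP.
have offdiag2 p q (i := lift ord0 p) (j := lift ord0 q) : p != q ->
    X i j * S2 p q + Z i j * T2 p q = 0.
  move=> /negPf pq; have /eqP := E2 p q; rewrite /= pq addr0 mulf_eq0.
  by rewrite (negPf (mulf_neq0 (gap_neq0 i) (gap_neq0 j))) => /eqP.
(* Cramer's rule for a pair of homogeneous equations in X i j and Z i j. *)
have sol2 i j s t s' t' : X i j * s + Z i j * t = 0 -> X i j * s' + Z i j * t' = 0 ->
    s * t' - s' * t != 0 -> X i j = 0 /\ Z i j = 0.
  move=> e e' D; split; apply: (mulIf D); rewrite mul0r.
    transitivity ((X i j * s + Z i j * t) * t' - (X i j * s' + Z i j * t') * t); first by ring.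
    by rewrite e e' !mul0r subrr.
  transitivity ((X i j * s' + Z i j * t') * s - (X i j * s + Z i j * t) * s'); first by ring.
  by rewrite e e' !mul0r subrr.
have neq0_frac (s v w : K) : v != 0 -> s * v = w -> w != 0 -> s != 0.
  by move=> v0 <-; rewrite mulf_eq0 negb_or => /andP[].
have sol0 i j : i != j -> Z i j = 0 -> S3 i j != 0 -> X i j = 0.
  move=> ij z0 s0; have /eqP := offdiag i j ij; rewrite z0 mul0r addr0 mulf_eq0.
  by rewrite (negPf s0) orbF => /eqP.
(* Subtracting the equation of the scalar representation eliminates u i from the diagonal
   equations. *)
have diagS i s t : d i * d i * (X i i * s + Z i i * t) + u i * d i = 0 ->
    X i i * (s - l i) + Z i i * (t - (l i)^-1) = 0.
  move=> e; apply: (mulfI (mulf_neq0 (gap_neq0 i) (gap_neq0 i))); rewrite mulr0.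
  transitivity (d i * d i * (X i i * s + Z i i * t) + u i * d i
    - (d i * d i * (X i i * l i + Z i i / l i) + u i * d i)); first by ring.
  by rewrite e E1 subrr.
have X01 : X 0 1 = 0.
  apply: sol0 => //; rewrite !mxE !I3S /=.
  by rewrite !mulf_neq0 ?invr_eq0 ?mulf_neq0 ?nzE.
have X02 : X 0 (-1) = 0.
  apply: sol0 => //; rewrite !mxE !I3S /=.
  by rewrite !mulf_neq0 ?invr_eq0 ?mulf_neq0 ?nzE.
have X10 : X 1 0 = 0.
  apply: sol0 => //; rewrite !mxE !I3S /=.
  by rewrite !mulf_neq0 ?invr_eq0 ?mulf_neq0 ?nzE.
have X20 : X (-1) 0 = 0.
  apply: sol0 => //; rewrite !mxE !I3S /=.
  by rewrite !mulf_neq0 ?invr_eq0 ?mulf_neq0 ?nzE // mulrC.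
(* The representations of dimensions 2 and 3 give two equations for the same pair of unknowns. The
   determinant is shown nonzero by giving its denominator and then its factored numerator. *)
have [X12 Z12] : X 1 (-1) = 0 /\ Z 1 (-1) = 0.
  have := offdiag2 0 1 isT; rewrite !I2S => e.
  apply: (sol2 _ _ _ _ _ _ (offdiag 1 (-1) isT) e).
  rewrite !mxE !(I3S, I2S) /=.
  apply: (neq0_frac _ (a * (b - c) * (c - b) * (b - a) * (b * c))
    (- b * c * (c ^+ 2 + a * b) * (a ^+ 2 + b * c))).
  - by rewrite !mulf_neq0 ?nzE.
  - by field; rewrite ?nzE.
  - by rewrite !mulf_neq0 ?oppr_eq0 ?nzE.
have [X21 Z21] : X (-1) 1 = 0 /\ Z (-1) 1 = 0.
  have := offdiag2 1 0 isT; rewrite !I2S => e.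
  apply: (sol2 _ _ _ _ _ _ (offdiag (-1) 1 isT) e).
  rewrite !mxE !(I3S, I2S) /=.
  apply: (neq0_frac _ (a * (c - a) * (c - b) * (b - c) * (b * c))
    (- (b ^+ 2 - b * c + c ^+ 2) * (b ^+ 2 + a * c) * (a ^+ 2 + b * c))).
  - by rewrite !mulf_neq0 ?nzE.
  - by field; rewrite ?nzE.
  - by rewrite !mulf_neq0 ?oppr_eq0 ?nzE.
have [X11 Z11] : X 1 1 = 0 /\ Z 1 1 = 0.
  have := E2 0 0; rewrite !I2S => /diagS e2.
  have := E3 1 1; rewrite eqxx => /diagS e3.
  apply: (sol2 _ _ _ _ _ _ e2 e3); rewrite !mxE !(I3S, I2S) /=.
  apply: (neq0_frac _ ((b - a) * (b - c) * (c - b) * (a * b * c))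
    ((b ^+ 2 - b * c + c ^+ 2) * (b ^+ 2 + a * c) * (a ^+ 2 + b * c))).
  - by rewrite !mulf_neq0 ?nzE.
  - by field; rewrite ?nzE.
  - by rewrite !mulf_neq0 ?nzE.
have [X22 Z22] : X (-1) (-1) = 0 /\ Z (-1) (-1) = 0.
  have := E2 1 1; rewrite !I2S => /diagS e2.
  have := E3 (-1) (-1); rewrite eqxx => /diagS e3.
  apply: (sol2 _ _ _ _ _ _ e2 e3); rewrite !mxE !(I3S, I2S) /=.
  apply: (neq0_frac _ ((c - a) * (c - b) * (b - c) * (a * b * c))
    ((b ^+ 2 - b * c + c ^+ 2) * (c ^+ 2 + a * b) * (a ^+ 2 + b * c))).
  - by rewrite !mulf_neq0 ?nzE.
  - by field; rewrite ?nzE.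
  - by rewrite !mulf_neq0 ?nzE.
(* Here Z 0 0 is already zero, so one equation suffices; its coefficient is [S3 0 0 - a]. *)
have X00 : X 0 0 = 0.
  have := E3 0 0; rewrite eqxx => /diagS; rewrite Z0r mul0r addr0 => /eqP.
  rewrite mulf_eq0 => /orP[/eqP//|]; apply/contraTeq => _.
  rewrite !mxE !I3S /=.
  apply: (neq0_frac _ ((a - b) * (a - c)) ((a ^+ 2 + b * c) * (b + c - a))).
  - by rewrite !mulf_neq0 ?nzE.
  - by field; rewrite ?nzE.
  - by rewrite !mulf_neq0.
have X0 : X = 0 by apply/matrixP => i j; rewrite mxE; elim/I3_ind: i; elim/I3_ind: j.
have Z0 : Z = 0 by apply/matrixP => i j; rewrite mxE; elim/I3_ind: i; elim/I3_ind: j.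
split=> // i; have /eqP := E1 i; rewrite X0 Z0 !mxE !mul0r addr0 mulr0 add0r mulf_eq0.
by rewrite (negPf (gap_neq0 i)) orbF => /eqP.
Qed.

End Representations.

(** * The basis *)

Import VectorInternalTheory.

Lemma vector_axiom_transfer (K : fieldType) (W : vectType K) (V : lmodType K)
  (L : {linear W -> V}) : bijective L -> inhabited (Vector.axiom (dim W) V).
Proof.
move=> [g Kg gK].
have g_lin k u v : g (k *: u + v) = k *: g u + g v.
  by apply: (can_inj Kg); rewrite gK linearP !gK.
constructor; exists (v2r \o g).
  by move=> k u v; rewrite /= g_lin linearP.
exists (L \o r2v) => v /=.
  by rewrite v2rK gK.
by rewrite Kg r2vK.
Qed.

Section Assembly.
Variables (R : comNzRingType) (A : algType R) (lR : 'I_3 -> R) (s1 t1 s2 t2 : A).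
Hypotheses (s1t1 : s1 * t1 = 1) (t1s1 : t1 * s1 = 1).
Hypotheses (s2t2 : s2 * t2 = 1) (t2s2 : t2 * s2 = 1).
Hypothesis braid : s1 * s2 * s1 = s2 * s1 * s2.
Hypothesis cubic1 : (s1 - (lR 0)%:A) * (s1 - (lR 1)%:A) * (s1 - (lR (-1))%:A) = 0.
Hypothesis cubic2 : (s2 - (lR 0)%:A) * (s2 - (lR 1)%:A) * (s2 - (lR (-1))%:A) = 0.
Local Notation xR := (lR 1 + lR (-1)).
Local Notation yR := (lR 1 * lR (-1)).
Hypothesis skein :
  - yR *: (s1 * t2 * s1) + yR ^+ 2 *: (t2 * s1 * t2) - s1 * s2 * s1
  - (xR * yR ^+ 2) *: (t2 * t2) + xR *: (s1 * s1) + yR ^+ 3 *: (t2 * t1 * t2) = 0.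
Hypothesis A_gen : forall Q : A -> Prop,
  (forall r m n, Q m -> Q n -> Q (r *: m + n)) -> Q 1 ->
  (forall m, Q m -> Q (s1 * m)) -> (forall m, Q m -> Q (s2 * m)) ->
  (forall m, Q m -> Q (t1 * m)) -> (forall m, Q m -> Q (t2 * m)) -> forall m, Q m.

Variables (K : fieldType) (h : {rmorphism R -> K}) (V : lmodType K) (iota : A -> V).
Hypothesis iota_linear : forall r m n, iota (r *: m + n) = h r *: iota m + iota n.
Hypothesis V_gen : forall Q : V -> Prop, (forall x y, Q x -> Q y -> Q (x - y)) ->
  (forall k m, Q (k *: iota m)) -> forall x, Q x.
Hypothesis V_lift : forall (W : lmodType K) (phi : A -> W),
  (forall r m n, phi (r *: m + n) = h r *: phi m + phi n) ->
  exists g : {linear V -> W}, forall m, g (iota m) = phi m.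

Local Notation l := (fun i => h (lR i)).
Local Notation a := (l 0).
Local Notation b := (l 1).
Local Notation c := (l (-1)).
Hypothesis l_neq0 : forall i, l i != 0.
Hypothesis lB_neq0 : forall i, l i - l (i + 1) != 0.
Hypothesis dagger : a ^+ 2 = b * c.
Hypothesis nondeg_bc : b ^+ 2 - b * c + c ^+ 2 != 0.
Hypothesis nondeg_a : a ^+ 2 + b * c != 0.
Hypothesis nondeg_b : b ^+ 2 + a * c != 0.
Hypothesis nondeg_c : c ^+ 2 + a * b != 0.
Hypothesis nondeg : b + c - a != 0.

Local Notation e := (eig lR s1).
Local Notation W0 := ('M[K]_3 * 'M[K]_2 * 'rV[K]_3)%type.

Lemma sum_scale_linear (U : lmodType K) (I : finType) k (f g : I -> K) (v : I -> U) :
  \sum_i (k * f i + g i) *: v i = k *: (\sum_i f i *: v i) + \sum_i g i *: v i.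
Proof.
by rewrite scaler_sumr -big_split; apply: eq_bigr => i _; rewrite scalerDl scalerA.
Qed.

Lemma sum_scale_delta (U : lmodType K) (I : finType) (i0 : I) (v : I -> U) :
  \sum_i (i == i0)%:R *: v i = v i0.
Proof.
rewrite (bigD1 i0) //= eqxx scale1r big1 ?addr0 // => i /negPf ->; exact: scale0r.
Qed.

(** The theorem amounts to the bijectivity of this map out of a space of dimension 9 + 4 + 3. *)
Definition from_coeffs (w : W0) : V :=
  \sum_(ij : 'I_3 * 'I_3) w.1.1 ij.1 ij.2 *: iota (e ij.1 * s2 * e ij.2)
  + \sum_(pq : 'I_2 * 'I_2) w.1.2 pq.1 pq.2 *:
      iota (e (lift ord0 pq.1) * t2 * e (lift ord0 pq.2))
  + \sum_i w.2 0 i *: iota (e i).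

Lemma from_coeffs_is_linear : linear from_coeffs.
Proof.
move=> k w w'; rewrite /from_coeffs.
under eq_bigr do rewrite !mxE; rewrite sum_scale_linear.
under [X in _ + X + _]eq_bigr do rewrite !mxE; rewrite sum_scale_linear.
under [X in _ + X]eq_bigr do rewrite !mxE; rewrite sum_scale_linear.
by rewrite !scalerDr [LHS](AC ((2*2)*2) ((1*3*5)*(2*4*6))) /=.
Qed.

HB.instance Definition _ := GRing.isLinear.Build K W0 V _ from_coeffs from_coeffs_is_linear.
Local Notation L := from_coeffs.

Definition spanned m := exists w, iota m = L w.

Lemma from_coeffs_sum (g : {linear V -> V}) w : (forall i, exists w, g (iota (e i)) = L w) ->
  (forall i j, exists w, g (iota (e i * s2 * e j)) = L w) ->
  (forall i j : 'I_2, exists w, g (iota (e (lift 0 i) * t2 * e (lift 0 j))) = L w) ->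
  exists w', g (L w) = L w'.
Proof.
move=> ge gs gt; rewrite /L !linearD !linear_sum.
have LD v v' : (exists w, v = L w) -> (exists w, v' = L w) -> exists w, v + v' = L w.
  by move=> [u ->] [u' ->]; exists (u + u'); rewrite linearD.
have Lsum (I : finType) (f : I -> V) : (forall i, exists w, f i = L w) ->
    exists w, \sum_i f i = L w.
  move=> Lf; apply: (big_ind (fun v => exists w, v = L w)) => //.
  by exists 0; rewrite linear0.
apply: (LD); first apply: (LD); apply: Lsum => i; rewrite linearZ /=.
- by case: (gs i.1 i.2) => u ->; exists (w.1.1 i.1 i.2 *: u); rewrite linearZ.
- by case: (gt i.1 i.2) => u ->; exists (w.1.2 i.1 i.2 *: u); rewrite linearZ.
by case: (ge i) => u ->; exists (w.2 0 i *: u); rewrite linearZ.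
Qed.

Lemma spanned_lin r m n : spanned m -> spanned n -> spanned (r *: m + n).
Proof. by move=> [u eu] [v ev]; exists (h r *: u + v); rewrite iota_linear eu ev linearP. Qed.

Lemma iotaZ r m : iota (r *: m) = h r *: iota m.
Proof.
have i0 : iota 0 = 0 by have := iota_linear (-1) 0 0; rewrite rmorphN1 !scaleN1r !addNr.
by rewrite -[r *: m]addr0 iota_linear i0 addr0.
Qed.

Lemma spanned_sat r m : h r != 0 -> spanned (r *: m) -> spanned m.
Proof.
move=> r0 [w]; rewrite iotaZ => E; exists ((h r)^-1 *: w).
by rewrite linearZ /= -E scalerA mulVf // scale1r.
Qed.

(** [V] carries no product here, so left multiplication by g is obtained by lifting [iota (g * m)]
    to a linear endomorphism, which is determined on the image of [from_coeffs] by the sixteen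
    generators. *)
Lemma spanned_mul g : (forall i, spanned (g * e i)) ->
  (forall i j, spanned (g * (e i * s2 * e j))) ->
  (forall i j : 'I_2, spanned (g * (e (lift 0 i) * t2 * e (lift 0 j)))) ->
  forall m, spanned m -> spanned (g * m).
Proof.
move=> ge gs gt m [w E].
have [|G GE] := V_lift (phi := fun m => iota (g * m)).
  by move=> r x y; rewrite mulrDr -scalerAr iota_linear.
rewrite /spanned -GE E; apply: from_coeffs_sum => [i|i j|i j]; rewrite GE.
- exact: ge.
- exact: gs.
- exact: gt.
Qed.

Lemma spanned_e i : spanned (e i).
Proof.
exists (0, 0, delta_mx 0 i); rewrite /L /=.
rewrite big1 => [|ij _]; last by rewrite mxE scale0r.
rewrite big1 => [|ij _]; last by rewrite mxE scale0r.
by rewrite !add0r; under eq_bigr do rewrite mxE eqxx /=; rewrite sum_scale_delta.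
Qed.

Lemma spanned_s i j : spanned (e i * s2 * e j).
Proof.
exists (delta_mx i j, 0, 0); rewrite /L /=.
rewrite [X in _ + X]big1 ?addr0 => [|k _]; last by rewrite mxE scale0r.
rewrite [X in _ + X]big1 ?addr0 => [|k _]; last by rewrite mxE scale0r.
under eq_bigr do rewrite mxE -xpair_eqE -surjective_pairing.
by rewrite sum_scale_delta.
Qed.

Lemma spanned_t i j : spanned (e (lift 0 i) * t2 * e (lift 0 j)).
Proof.
exists (0, delta_mx i j, 0); rewrite /L /=.
rewrite [X in _ + X]big1 ?addr0 => [|k _]; last by rewrite mxE scale0r.
rewrite [X in X + _]big1 ?add0r => [|k _]; last by rewrite mxE scale0r.
under eq_bigr do rewrite mxE -xpair_eqE -surjective_pairing.
by rewrite sum_scale_delta.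
Qed.

Lemma spanned_all m : spanned m.
Proof.
(* Division is possible exactly by the scalars that become invertible in the field [K]. *)
pose sat r := h r != 0.
have satM r r' : sat r -> sat r' -> sat (r * r') by rewrite /sat rmorphM; apply: mulf_neq0.
have sat_lB i : sat (lR i - lR (i + 1)) by rewrite /sat rmorphB.
have [m1 ms1 ms2 mt1 mt2] := @skein_algebra_mem _ _ lR _ _ _ _ s1t1 t1s1 s2t2 t2s2 braid
  cubic1 cubic2 skein sat spanned spanned_lin satM spanned_sat l_neq0 sat_lB
  spanned_e spanned_s spanned_t spanned_mul.
exact: A_gen spanned_lin m1 ms1 ms2 mt1 mt2 m.
Qed.

Lemma from_coeffs_onto v : exists w, v = L w.
Proof.
elim/V_gen: v => [_ _ [u ->] [v ->]|k m]; first by exists (u - v); rewrite linearB.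
by have [w ->] := spanned_all m; exists (k *: w); rewrite linearZ.
Qed.

(** * Coefficients read off from matrix entries *)

Section Evaluation.
Variables (n : nat) (nu : 'I_n.+1 -> 'I_3) (S T : 'M[K]_n.+1) (phi : A -> 'M[K]_n.+1).
Hypothesis phiL : forall r m m', phi (r *: m + m') = h r *: phi m + phi m'.
Hypothesis phiM : forall m m', phi (m * m') = phi m * phi m'.
Hypothesis phi1 : phi 1 = 1.
Hypothesis phi_s1 : phi s1 = diag_mx (\row_p l (nu p)).
Hypothesis phi_s2 : phi s2 = S.
Hypothesis phi_t2 : phi t2 = T.
Local Notation d := (gap l).

(** The factors l_j, j distinct from i, cancel every coordinate with another eigenvalue; what
    remains is a multiple of the projection to the l_i-eigenspace. *)
Lemma phi_eig i : phi (e i) = diag_mx (\row_p (d i *+ (nu p == i))).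
Proof.
have phiB r : phi (s1 - r%:A) = diag_mx (\row_p (l (nu p) - h r)).
  rewrite addrC -scaleNr phiL phi1 phi_s1 rmorphN scaleNr addrC scalar_diag.
  by rewrite -raddfB; congr diag_mx; apply/rowP=> p; rewrite !mxE.
rewrite eig_unlock phiM !phiB -mulmxE mulmx_diag; congr diag_mx.
apply/rowP=> p; rewrite !mxE /gap; have [->//|] := eqVneq (nu p) i.
elim/I3_ind: i; elim/I3_ind: (nu p); rewrite ?eqxx // !I3S.
all: by rewrite subrr ?(mul0r, mulr0).
Qed.

Lemma phi_sandwich m i j p q : phi (e i * m * e j) p q =
  ((i, j) == (nu p, nu q))%:R * (d (nu p) * d (nu q) * phi m p q).
Proof.
rewrite !phiM !phi_eig -!mulmxE mul_diag_mx mul_mx_diag !mxE xpair_eqE.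
rewrite ![_ == nu _]eq_sym; case: eqP => [->|_]; case: eqP => [->|_] /=;
  by rewrite ?(mul0r, mulr0, mulr1n, mul1r) // mulrAC.
Qed.

(** Extension by zero to the row and column of a, giving the coefficients of s2 and s2^-1 the same
    shape. *)
Definition zext (Z : 'M[K]_2) : 'M[K]_3 := \matrix_(i, j)
  \sum_(pq : 'I_2 * 'I_2) Z pq.1 pq.2 * ((lift ord0 pq.1, lift ord0 pq.2) == (i, j))%:R.

(** An entry (p, q) sees only the coefficients at ([nu p], [nu q]), together with one u on the
    diagonal. This decouples the independence problem into small systems. *)
Lemma eval_from_coeffs (g : {linear V -> 'M[K]_n.+1}) w p q :
  (forall m, g (iota m) = phi m) -> let i := nu p in let j := nu q in
  g (L w) p q = d i * d j * (w.1.1 i j * S p q + zext w.1.2 i j * T p q)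
    + (w.2 0 i * d i) *+ (p == q).
Proof.
move=> gE i j; rewrite /L !linearD !linear_sum /= !mxE !summxE mulrDr.
congr (_ + _ + _).
- rewrite (bigD1 (i, j)) //= big1 => [|ij ne]; rewrite linearZ gE /= mxE phi_sandwich.
    by rewrite eqxx addr0 mul1r phi_s2 mulrCA.
  by rewrite -surjective_pairing (negPf ne) mul0r mulr0.
- rewrite mulr_suml mulr_sumr; apply: eq_bigr => k _.
  rewrite linearZ gE /= mxE phi_sandwich phi_t2; ring.
rewrite (bigD1 i) //= big1 => [|k ne]; rewrite linearZ gE /= mxE phi_eig !mxE.
  by rewrite eqxx addr0 mulr1n mulrnAr.
by rewrite eq_sym (negPf ne) mul0rn mulr0.
Qed.

End Evaluation.

Lemma zext0l Z i : zext Z 0 i = 0.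
Proof. by rewrite mxE big1 // => k _; rewrite xpair_eqE mulr0. Qed.

Lemma zext0r Z i : zext Z i 0 = 0.
Proof. by rewrite mxE big1 // => k _; rewrite xpair_eqE andbF mulr0. Qed.

Lemma zext_lift Z i j : zext Z (lift ord0 i) (lift ord0 j) = Z i j.
Proof.
rewrite mxE (bigD1 (i, j)) //= eqxx mulr1 big1 ?addr0 // => -[p q] ne.
by rewrite xpair_eqE !(inj_eq lift_inj) -xpair_eqE (negPf ne) mulr0.
Qed.

Hypothesis reps : forall n (nu : 'I_n.+1 -> 'I_3) (S T : 'M[K]_n.+1),
  (forall p q, \sum_k S p k * T k q = (p == q)%:R) ->
  (forall p q, l (nu p) * S p q * l (nu q) = \sum_k S p k * l (nu k) * S k q) ->
  (forall p q, let mu := l (nu p) - (b + c) + b * c / l (nu p) in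
    mu * S p q * l (nu q) ^+ 2 = (b * c) ^+ 2 * (mu * T p q)) ->
  exists phi : A -> 'M[K]_n.+1,
    [/\ forall r m m', phi (r *: m + m') = h r *: phi m + phi m',
        forall m m', phi (m * m') = phi m * phi m' & phi 1 = 1]
    /\ [/\ phi s1 = diag_mx (\row_p l (nu p)), phi s2 = S & phi t2 = T].

Lemma from_coeffs_inj0 w : L w = 0 -> w = 0.
Proof.
case: w => -[X Z] u Lw.
have eval n (nu : 'I_n.+1 -> 'I_3) (S T : 'M[K]_n.+1) :
    (forall p q, \sum_k S p k * T k q = (p == q)%:R) ->
    (forall p q, l (nu p) * S p q * l (nu q) = \sum_k S p k * l (nu k) * S k q) ->
    (forall p q, let mu := l (nu p) - (b + c) + b * c / l (nu p) in
      mu * S p q * l (nu q) ^+ 2 = (b * c) ^+ 2 * (mu * T p q)) ->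
    forall p q, gap l (nu p) * gap l (nu q)
      * (X (nu p) (nu q) * S p q + zext Z (nu p) (nu q) * T p q)
      + (u 0 (nu p) * gap l (nu p)) *+ (p == q) = 0.
  move=> ST br sk p q.
  have [phi [[phiL phiM phi1] [phi_s1 phi_s2 phi_t2]]] := reps ST br sk.
  have [g gE] := V_lift phiL.
  have := eval_from_coeffs phiL phiM phi1 phi_s1 phi_s2 phi_t2 (X, Z, u) p q gE.
  by rewrite Lw linear0 mxE => <-.
have [|||||X0 Z0 u0] := @coefficients_eq0 K l l_neq0 lB_neq0
  nondeg_bc nondeg_a nondeg_b nondeg_c nondeg X (zext Z) (u 0).
- exact: zext0l.
- exact: zext0r.
(* Matrices have size [n.+1], so 0, 1 and 2 select dimensions 1, 2 and 3. Here both generators act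
   by the scalar l i. *)
- move=> i; have := @eval 0%N (fun=> i) (l i)%:M (l i)^-1%:M.
  have one_entry k : (k%:M : 'M[K]_1) 0 0 = k by rewrite mxE mulr1n.
  move=> /(_ _ _ _ 0 0); rewrite !one_entry mulr1n; apply=> p q; rewrite ?ord1 ?big_ord1.
  + by rewrite !one_entry mulfV.
  + by rewrite !one_entry.
  + by rewrite !one_entry; apply: (@scalar_skein K l).
- move=> p q i j; rewrite -(@eval 1 (lift ord0) (S2 l) (T2 l) _ _ _ p q) //.
  + exact: S2T2.
  + exact: S2_braid.
  + exact: S2_skein.
- move=> i j; rewrite -(@eval 2 id (S3 l) (T3 l) _ _ _ i j) //.
  + exact: S3T3.
  + exact: S3_braid.
  + exact: S3_skein.
congr (_, _, _); first by [].
  by apply/matrixP=> i j; rewrite -zext_lift Z0 !mxE.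
by apply/rowP=> i; rewrite u0 mxE.
Qed.

Lemma dimension_16 : inhabited (Vector.axiom 16 V).
Proof.
have L_inj : injective L.
  move=> u v E; apply/eqP; rewrite -subr_eq0; apply/eqP/from_coeffs_inj0.
  by rewrite linearB /= E subrr.
pose g v := projT1 (cid (from_coeffs_onto v)).
have gK v : L (g v) = v by rewrite /g; case: cid.
(* The dimension of [W0] computes to 3 * 3 + 2 * 2 + 1 * 3, that is 16. *)
apply: (vector_axiom_transfer (W := W0 : vectType K) (L := L)).
by exists g => [w|//]; apply: L_inj; rewrite gK.
Qed.

End Assembly.

(** * The parameters in the field K^dagger *)

Definition polyR (p : Qabc) : ringR := RingR (RbP p).

Lemma polyR_zmod : zmod_morphism polyR.
Proof. by move=> p q; apply/val_inj; apply: tofracB. Qed.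
Lemma polyR_monoid : monoid_morphism polyR.
Proof. by split=> [|p q]; apply/val_inj; [apply: tofrac1 | apply: tofracM]. Qed.
HB.instance Definition _ := GRing.isZmodMorphism.Build Qabc ringR polyR polyR_zmod.
HB.instance Definition _ := GRing.isMonoidMorphism.Build Qabc ringR polyR polyR_monoid.

Definition R_to_Kdag : ringR -> Kdag := Sdag_to_Kdag \o R_to_Sdag.
HB.instance Definition _ := GRing.RMorphism.on R_to_Kdag.

Lemma Sdag_pi_eq0 (s : ringS) : \pi_Sdag s = 0 -> s \in dagger_ideal.
Proof.
move=> E; rewrite -[s]subr0 Quotient.idealrBE; apply/eqP.
by rewrite E [RHS](_ : _ = 0) //; apply: (rmorph0 \pi_Sdag).
Qed.

(* The point (2, 1, 4) lies on the surface a^2 = b c, so a polynomial which does not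
   vanish there is nonzero in the function field of the surface. *)
Definition test_point (i : 'I_3) : rat := nth 0 [:: 2%:R; 1; 4%:R] i.

Lemma R_to_Kdag_neq0 p : p.@[test_point] != 0 -> R_to_Kdag (polyR p) != 0.
Proof.
apply: contraNneq => /eqP; rewrite tofrac_eq0 => /eqP /Sdag_pi_eq0.
have e : val (R_to_S (polyR p)) * FracField.tofrac (1 : Qabc) = FracField.tofrac p.
  by rewrite tofrac1 mulr1.
rewrite (dagger_idealE dagger_den1 e) => /eqP /psi_ker [N [g E]].
(* At this point b = 1, so the power of b disappears, and a^2 - b c = 4 - 4 kills the right-hand
   side. *)
have := congr1 (meval test_point) E.
rewrite !rmorphM rmorphXn rmorphB rmorphXn rmorphM /= !mevalXU.
rewrite /test_point !inordK //= expr1n mul1r => ->.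
by rewrite expr2 -!natrM mul1r subrr mul0r.
Qed.

Lemma Kdag_dagger : R_to_Kdag aR ^+ 2 = R_to_Kdag bR * R_to_Kdag cR.
Proof.
have J0 : R_to_Sdag (aR ^+ 2) = R_to_Sdag yR.
  apply/eqP; rewrite -Quotient.idealrBE; apply/asboolP.
  by exists 1; rewrite mulr1 rmorphXn.
have <- : R_to_Kdag yR = R_to_Kdag bR * R_to_Kdag cR := rmorphM R_to_Kdag bR cR.
by rewrite -rmorphXn; apply: (congr1 Sdag_to_Kdag J0).
Qed.

Theorem proposition4p7 : inhabited (@Vector.axiom Kdag 16 BMWdagK).
Proof.
pose k p := R_to_Kdag (polyR p).
have k_neq0 p : p.@[test_point] != 0 -> k p != 0 := @R_to_Kdag_neq0 p.
have kD p q : k (p + q) = k p + k q by rewrite /k !raddfD.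
have kB p q : k (p - q) = k p - k q by rewrite /k !raddfB.
have kM p q : k (p * q) = k p * k q by rewrite /k !rmorphM.
have kX p n : k (p ^+ n) = k p ^+ n by rewrite /k !rmorphXn.
have ev : (aP.@[test_point] = 2%:R) * (bP.@[test_point] = 1) * (cP.@[test_point] = 4%:R).
  by rewrite !mevalXU /test_point !inordK.
pose MA : lmodType Sdag := BMWdag.
pose i : BMW -> MA := bc_in R_to_Sdag (M := BMW).
pose j : MA -> BMWdagK := bc_in Sdag_to_Kdag (M := BMWdag).
have i_lin r x y : i (r *: x + y) = R_to_Sdag r *: i x + i y.
  exact: (bc_in_linear R_to_Sdag r (x : BMW) y).
have j_lin r x y : j (r *: x + y) = Sdag_to_Kdag r *: j x + j y.
  exact: (bc_in_linear Sdag_to_Kdag r (x : BMWdag) y).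
have V_gen := tower_ind j_lin (bc_ind (f := R_to_Sdag) (M := BMW))
  (bc_ind (f := Sdag_to_Kdag) (M := BMWdag)).
(* The inner lift goes directly into a [Kdag]-space along [Sdag_to_Kdag]; the outer one is then
   ordinary linear extension, along the identity. *)
have V_lift W := tower_lift (bc_lift (f := R_to_Sdag) (M := BMW) (h := Sdag_to_Kdag) (V := W))
  (bc_lift (f := Sdag_to_Kdag) (M := BMWdag) (h := idfun) (V := W)).
have V_lin := tower_linear i_lin j_lin.
apply: (@dimension_16 ringR BMW eigR (bmw_gen ord0) (bmw_genV ord0) (bmw_gen ord_max)
  (bmw_genV ord_max) (bmw_genK _) (bmw_genVK _) (bmw_genK _) (bmw_genVK _) bmw_braid
  (bmw_cubic _) (bmw_cubic _) bmw_skein _ Kdag R_to_Kdag BMWdagK (fun m => j (i m))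
  V_lin V_gen V_lift).
- move=> Q Ql Q1 Qs1 Qs2 Qt1 Qt2; apply: (bmw_ind Ql Q1) => g m Qm.
    have [->|->] := I2_cases g; [exact: Qs1 | exact: Qs2].
  have [->|->] := I2_cases g; [exact: Qt1 | exact: Qt2].
(* All nonvanishing conditions are tested at (2, 1, 4): the cyclic differences are 1, -3, 2 and the
   five remaining polynomials take the values 13, 8, 9, 18, 3. *)
- elim/I3_ind; [apply: (k_neq0 aP)|apply: (k_neq0 bP)|apply: (k_neq0 cP)]; by rewrite ev.
- elim/I3_ind.
  + change (k aP - k bP != 0); rewrite -kB; apply: k_neq0.
    by rewrite rmorphB /= !ev.
  + change (k bP - k cP != 0); rewrite -kB; apply: k_neq0.
    by rewrite rmorphB /= !ev.
  + change (k cP - k aP != 0); rewrite -kB; apply: k_neq0.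
    by rewrite rmorphB /= !ev.
- exact: Kdag_dagger.
- change (k bP ^+ 2 - k bP * k cP + k cP ^+ 2 != 0).
  rewrite -!kX -kM -kB -kD; apply: k_neq0.
  by rewrite rmorphD rmorphB !rmorphXn rmorphM /= !ev.
- change (k aP ^+ 2 + k bP * k cP != 0); rewrite -kX -kM -kD; apply: k_neq0.
  by rewrite rmorphD rmorphXn rmorphM /= !ev.
- change (k bP ^+ 2 + k aP * k cP != 0); rewrite -kX -kM -kD; apply: k_neq0.
  by rewrite rmorphD rmorphXn rmorphM /= !ev.
- change (k cP ^+ 2 + k aP * k bP != 0); rewrite -kX -kM -kD; apply: k_neq0.
  by rewrite rmorphD rmorphXn rmorphM /= !ev.
- change (k bP + k cP - k aP != 0); rewrite -kD -kB; apply: k_neq0.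
  by rewrite rmorphB rmorphD /= !ev.
move=> n nu S T ST br sk.
have l0 p : R_to_Kdag (eigR p) != 0.
  elim/I3_ind: p; [apply: (k_neq0 aP)|apply: (k_neq0 bP)|apply: (k_neq0 cP)]; by rewrite ev.
have [phi [phiL phiM phi1 phiS phiT]] := diag_representation l0 ST br sk.
by exists phi; split; split=> //; rewrite ?phiS ?phiT.
Qed.
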